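(* Let $I,J,M,N\subseteq\{1,\dots,n\}$ with $|I|=|J|$ and $|M|=|N|$. Then in $A=\mathcal{O}_q(M_n(k))$, $$q^{|J\cap N|}[I|J][M|N]=q^{|I\cap M|}[M|N][I|J]+q^{|I\cap M|}\sum_{\substack{S\in\{\ge I\Vert M\}\\ T\in\{\le J\Vert N\}\\ (S,T)\ne(I,J)}}\mu_S\,\widetilde{\lambda}_T\,[S^\natural|T^\natural][S|T],$$ where $S^\natural=S^\natural_{I,M}$, $T^\natural=T^\natural_{J,N}$, and $$\mu_S=\widehat{q}^{\,|S\setminus I|}(-q)^{\mathcal{L}^\natural(S,I,M)}\xi_q(S\setminus I;I\setminus S),\qquad \widetilde{\lambda}_T=(-\widehat{q})^{|J\setminus T|}(-q)^{-\mathcal{L}(T,J,N)}\xi_q(J\setminus T;T\setminus J)$$ for $S\in\{\ge I\Vert M\}$ and $T\in\{\le J\Vert N\}$.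
   Context: Let $k$ be a field, $n$ a positive integer, $q\in k^\times$, and $\widehat{q}=q-q^{-1}$. The algebra $A=\mathcal{O}_q(M_n(k))$ is the $k$-algebra with generators $X_{ij}$ ($1\le i,j\le n$) and relations: $X_{ij}X_{lj}=qX_{lj}X_{ij}$ for $i<l$; $X_{ij}X_{im}=qX_{im}X_{ij}$ for $j<m$; $X_{ij}X_{lm}=X_{lm}X_{ij}$ for $i<l$, $j>m$; $X_{ij}X_{lm}-X_{lm}X_{ij}=\widehat{q}\,X_{im}X_{lj}$ for $i<l$, $j<m$. Quantum minors: for $I=\{i_1<\cdots<i_t\}$ and $J=\{j_1<\cdots<j_t\}$, $[I|J]=\sum_{\sigma\in S_t}(-q)^{\ell(\sigma)}X_{i_1,j_{\sigma(1)}}\cdots X_{i_t,j_{\sigma(t)}}$, where $\ell(\sigma)$ is the length (number of inversions) of $\sigma$; $[\varnothing|\varnothing]=1$. For such $I,J$, $I\le J$ means $i_l\le j_l$ for all $l$. For $S,T\subseteq\{1,\dots,n\}$, $\ell(S;T)=|\{(s,t)\in S\times T\mid s>t\}|$. For $d\in\mathbb{N}$, $[d]_{-q}=(-q)^{d-1}+(-q)^{d-3}+\cdots+(-q)^{-(d-1)}$. For index sets $U\ge V$ of the same cardinality $m$, write $U=\{r_1<\cdots<r_m\}$, set $d_l=|[1,r_l]\cap V|-l+1$ (which is $\ge1$) and define $\xi_q(U;V)=[d_1]_{-q}\cdots[d_m]_{-q}$, with $\xi_q(\varnothing;\varnothing)=1$. For $X,Y\subseteq\{1,\dots,n\}$: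 $\{\le X\Vert Y\}=\{S\subseteq X\cup Y\mid X\cap Y\subseteq S,\ |S|=|X|,\ S\le X\}$ and $\{\ge X\Vert Y\}=\{T\subseteq X\cup Y\mid X\cap Y\subseteq T,\ |T|=|X|,\ T\ge X\}$. For $X\cap Y\subseteq S\subseteq X\cup Y$, $S^\natural=S^\natural_{X,Y}=(X\cap Y)\sqcup\bigl((X\cup Y)\setminus S\bigr)$. For $S\in\{\le X\Vert Y\}$ and $T\in\{\ge X\Vert Y\}$ (with $\natural$ taken relative to $X,Y$), $\mathcal{L}(S,X,Y)=\ell\bigl((S\setminus S^\natural)\cup(Y\setminus X);X\setminus S\bigr)-\ell\bigl((S\setminus S^\natural)\cup(Y\setminus X);S\setminus X\bigr)$, $\mathcal{L}^\natural(T,X,Y)=\ell\bigl((T^\natural\setminus T)\cup(X\setminus Y);T\setminus X\bigr)-\ell\bigl((T^\natural\setminus T)\cup(X\setminus Y);X\setminus T\bigr)$. *)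

(* Defs.v *)
From HB Require Import structures.
From mathcomp Require Import all_boot perm all_algebra.
From mathcomp Require Import boolp.

Set Implicit Arguments.
Unset Strict Implicit.
Unset Printing Implicit Defensive.

Import GRing.Theory.
Local Open Scope ring_scope.
Local Open Scope quotient_scope.

(* The algebra O_q(M_n(k)) is the type of formal noncommutative expressions in
   the X_ij with coefficients in k, modulo the least congruence [qmx_eq] that
   contains the axioms of a unital associative k-algebra and the defining
   relations [qmx_rel].  Rows and columns are numbered from 0 ('I_n). *)

Inductive qmx_term (k : Type) (n : nat) : Type :=
| QGen of 'I_n & 'I_n
| QCst of k
| QAdd of qmx_term k n & qmx_term k n
| QOpp of qmx_term k n
| QMul of qmx_term k n & qmx_term k n.

Arguments QGen {k n} i j.
Arguments QCst {k n} c.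

HB.instance Definition _ (k : Type) (n : nat) := gen_eqMixin (qmx_term k n).
HB.instance Definition _ (k : Type) (n : nat) := gen_choiceMixin (qmx_term k n).

Declare Scope qmx_scope.
Delimit Scope qmx_scope with qmx.
Bind Scope qmx_scope with qmx_term.
Local Notation "x + y" := (QAdd x y) : qmx_scope.
Local Notation "- x" := (QOpp x) : qmx_scope.
Local Notation "x - y" := (QAdd x (QOpp y)) : qmx_scope.
Local Notation "x * y" := (QMul x y) : qmx_scope.

Section QuantumMatrices.
Variables (k : fieldType) (n : nat) (q : k).

Definition qhat : k := q - q^-1.

Local Notation X := (@QGen k n).
Local Notation "c %:C" := (@QCst k n c) (at level 2, left associativity).

Inductive qmx_rel : qmx_term k n -> qmx_term k n -> Prop :=
| QRcol (i l j : 'I_n) : (i < l)%N ->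
    qmx_rel (X i j * X l j) (q%:C * (X l j * X i j))
| QRrow (i j m : 'I_n) : (j < m)%N ->
    qmx_rel (X i j * X i m) (q%:C * (X i m * X i j))
| QRcomm (i l j m : 'I_n) : (i < l)%N -> (m < j)%N ->
    qmx_rel (X i j * X l m) (X l m * X i j)
| QRcross (i l j m : 'I_n) : (i < l)%N -> (j < m)%N ->
    qmx_rel (X i j * X l m - X l m * X i j) (qhat%:C * (X i m * X l j)).

Inductive qmx_eq : qmx_term k n -> qmx_term k n -> Prop :=
| QErefl a : qmx_eq a a
| QEsym a b : qmx_eq a b -> qmx_eq b a
| QEtrans a b c : qmx_eq a b -> qmx_eq b c -> qmx_eq a c
| QEadd a a' b b' : qmx_eq a a' -> qmx_eq b b' -> qmx_eq (a + b) (a' + b')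
| QEopp a a' : qmx_eq a a' -> qmx_eq (- a) (- a')
| QEmul a a' b b' : qmx_eq a a' -> qmx_eq b b' -> qmx_eq (a * b) (a' * b')
| QEaddA a b c : qmx_eq (a + (b + c)) (a + b + c)
| QEaddC a b : qmx_eq (a + b) (b + a)
| QEadd0 a : qmx_eq (0%:C + a) a
| QEaddN a : qmx_eq (- a + a) 0%:C
| QEmulA a b c : qmx_eq (a * (b * c)) (a * b * c)
| QEmul1l a : qmx_eq (1%:C * a) a
| QEmul1r a : qmx_eq (a * 1%:C) a
| QEmulDl a b c : qmx_eq ((a + b) * c) (a * c + b * c)
| QEmulDr a b c : qmx_eq (a * (b + c)) (a * b + a * c)
| QEcstD c d : qmx_eq (c + d)%R%:C (c%:C + d%:C)
| QEcstM c d : qmx_eq (c * d)%R%:C (c%:C * d%:C)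
| QEcstC c a : qmx_eq (c%:C * a) (a * c%:C)
| QErel a b : qmx_rel a b -> qmx_eq a b.

Definition qmx_eqb (a b : qmx_term k n) : bool := `[< qmx_eq a b >].

Lemma qmx_eqb_refl : reflexive qmx_eqb.
Proof. by move=> a; apply/asboolP; exact: QErefl. Qed.

Lemma qmx_eqb_sym : symmetric qmx_eqb.
Proof. by move=> a b; apply/asboolP/asboolP; exact: QEsym. Qed.

Lemma qmx_eqb_trans : transitive qmx_eqb.
Proof.
move=> b a c /asboolP ab /asboolP bc; apply/asboolP; exact: QEtrans ab bc.
Qed.

Canonical qmx_equiv := EquivRel qmx_eqb qmx_eqb_refl qmx_eqb_sym qmx_eqb_trans.

Definition Oq := {eq_quot qmx_equiv}.

HB.instance Definition _ := EqQuotient.on Oq.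
HB.instance Definition _ := Choice.on Oq.

Definition oq_pi (a : qmx_term k n) : Oq := \pi_Oq a.

Lemma oq_piP a b : oq_pi a = oq_pi b <-> qmx_eq a b.
Proof. by split=> [/eqmodP/asboolP|ab]; last exact/eqmodP/asboolP. Qed.

Lemma oq_reprK (x : Oq) : oq_pi (repr x) = x.
Proof. exact: reprK. Qed.

Lemma oq_repr a : qmx_eq (repr (oq_pi a)) a.
Proof. by apply/oq_piP; rewrite oq_reprK. Qed.

Definition oq_zero : Oq := oq_pi 0%:C.
Definition oq_one : Oq := oq_pi 1%:C.
Definition oq_add (x y : Oq) : Oq := oq_pi (repr x + repr y).
Definition oq_opp (x : Oq) : Oq := oq_pi (- repr x).
Definition oq_mul (x y : Oq) : Oq := oq_pi (repr x * repr y).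
Definition oq_scale (c : k) (x : Oq) : Oq := oq_pi (c%:C * repr x).

Lemma oq_piD a b : oq_pi (a + b) = oq_add (oq_pi a) (oq_pi b).
Proof. by apply/oq_piP/QEsym/QEadd; exact: oq_repr. Qed.

Lemma oq_piN a : oq_pi (- a) = oq_opp (oq_pi a).
Proof. by apply/oq_piP/QEsym/QEopp/oq_repr. Qed.

Lemma oq_piM a b : oq_pi (a * b) = oq_mul (oq_pi a) (oq_pi b).
Proof. by apply/oq_piP/QEsym/QEmul; exact: oq_repr. Qed.

Lemma oq_piZ c a : oq_pi (c%:C * a) = oq_scale c (oq_pi a).
Proof. by apply/oq_piP/QEsym/QEmul; [exact: QErefl | exact: oq_repr]. Qed.

Lemma oq_ind (P : Oq -> Prop) : (forall a, P (oq_pi a)) -> forall x, P x.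
Proof. by move=> H x; rewrite -(oq_reprK x). Qed.

Fact oq_addA : associative oq_add.
Proof.
elim/oq_ind=> a; elim/oq_ind=> b; elim/oq_ind=> c.
by rewrite -!oq_piD; apply/oq_piP/QEaddA.
Qed.

Fact oq_addC : commutative oq_add.
Proof.
by elim/oq_ind=> a; elim/oq_ind=> b; rewrite -!oq_piD; apply/oq_piP/QEaddC.
Qed.

Fact oq_add0 : left_id oq_zero oq_add.
Proof. by elim/oq_ind=> a; rewrite -oq_piD; apply/oq_piP/QEadd0. Qed.

Fact oq_addN : left_inverse oq_zero oq_opp oq_add.
Proof.
by elim/oq_ind=> a; rewrite -oq_piN -oq_piD; apply/oq_piP/QEaddN.
Qed.

HB.instance Definition _ :=
  GRing.isZmodule.Build Oq oq_addA oq_addC oq_add0 oq_addN.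

Fact oq_mulA : associative oq_mul.
Proof.
elim/oq_ind=> a; elim/oq_ind=> b; elim/oq_ind=> c.
by rewrite -!oq_piM; apply/oq_piP/QEmulA.
Qed.

Fact oq_mul1l : left_id oq_one oq_mul.
Proof. by elim/oq_ind=> a; rewrite -oq_piM; apply/oq_piP/QEmul1l. Qed.

Fact oq_mul1r : right_id oq_one oq_mul.
Proof. by elim/oq_ind=> a; rewrite -oq_piM; apply/oq_piP/QEmul1r. Qed.

Fact oq_mulDl : left_distributive oq_mul oq_add.
Proof.
elim/oq_ind=> a; elim/oq_ind=> b; elim/oq_ind=> c.
by rewrite -oq_piD -!oq_piM -oq_piD; apply/oq_piP/QEmulDl.
Qed.

Fact oq_mulDr : right_distributive oq_mul oq_add.
Proof.
elim/oq_ind=> a; elim/oq_ind=> b; elim/oq_ind=> c.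
by rewrite -oq_piD -!oq_piM -oq_piD; apply/oq_piP/QEmulDr.
Qed.

Section Evaluation.
Variables (B : algType k) (Y : 'I_n -> 'I_n -> B).

Fixpoint qmx_eval (a : qmx_term k n) : B :=
  match a with
  | QGen i j => Y i j
  | QCst c => c%:A
  | QAdd a b => qmx_eval a + qmx_eval b
  | QOpp a => - qmx_eval a
  | QMul a b => qmx_eval a * qmx_eval b
  end.

Hypothesis Yrel : forall a b, qmx_rel a b -> qmx_eval a = qmx_eval b.

Lemma qmx_eval_eq a b : qmx_eq a b -> qmx_eval a = qmx_eval b.
Proof.
elim=> {a b} //=.
- by move=> a b c _ -> _ ->.
- by move=> a a' b b' _ -> _ ->.
- by move=> a a' _ ->.
- by move=> a a' b b' _ -> _ ->.
- by move=> a b c; rewrite addrA.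
- by move=> a b; rewrite addrC.
- by move=> a; rewrite scale0r add0r.
- by move=> a; rewrite scale0r addNr.
- by move=> a b c; rewrite mulrA.
- by move=> a; rewrite scale1r mul1r.
- by move=> a; rewrite scale1r mulr1.
- by move=> a b c; rewrite mulrDl.
- by move=> a b c; rewrite mulrDr.
- by move=> c d; rewrite scalerDl.
- by move=> c d; rewrite -scalerAl mul1r scalerA.
- by move=> c a; rewrite -scalerAl -scalerAr mul1r mulr1.
Qed.

End Evaluation.

Fact oq_one_neq0 : oq_one != 0.
Proof.
apply/eqP=> /oq_piP /(@qmx_eval_eq k^o (fun _ _ => 0)) /=.
rewrite scale1r scale0r => H; suff /H /eqP : forall a b, qmx_rel a b ->
    @qmx_eval k^o (fun _ _ => 0) a = @qmx_eval k^o (fun _ _ => 0) b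
  by rewrite oner_eq0.
by move=> a b [] *; rewrite /= !(mul0r, mulr0, subrr).
Qed.

HB.instance Definition _ := GRing.Zmodule_isNzRing.Build Oq
  oq_mulA oq_mul1l oq_mul1r oq_mulDl oq_mulDr oq_one_neq0.

Fact oq_scaleA c d (x : Oq) : oq_scale c (oq_scale d x) = oq_scale (c * d) x.
Proof.
elim/oq_ind: x => a; rewrite -!oq_piZ; apply/oq_piP.
apply: QEtrans (QEmulA _ _ _) _; apply: QEmul (QErefl _).
exact/QEsym/QEcstM.
Qed.

Fact oq_scale1 : left_id 1 oq_scale.
Proof. by elim/oq_ind=> a; rewrite -oq_piZ; apply/oq_piP/QEmul1l. Qed.

Fact oq_scaleDr : right_distributive oq_scale +%R.
Proof.
move=> c; elim/oq_ind=> a; elim/oq_ind=> b.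
by rewrite -[oq_pi a + _]oq_piD -!oq_piZ -[RHS]oq_piD; apply/oq_piP/QEmulDr.
Qed.

Fact oq_scaleDl (x : Oq) : {morph oq_scale^~ x : c d / c + d}.
Proof.
move=> c d /=; elim/oq_ind: x => a; rewrite -!oq_piZ -[RHS]oq_piD.
apply/oq_piP; apply: QEtrans (QEmulDl _ _ _).
exact: QEmul (QEcstD _ _) (QErefl _).
Qed.

HB.instance Definition _ := GRing.Zmodule_isLmodule.Build k Oq
  oq_scaleA oq_scale1 oq_scaleDr oq_scaleDl.

Fact oq_scaleAl (c : k) (x y : Oq) : c *: (x * y) = (c *: x) * y.
Proof.
elim/oq_ind: x => a; elim/oq_ind: y => b.
rewrite -[oq_pi a * _]oq_piM -[LHS]oq_piZ -[c *: oq_pi a]oq_piZ -[RHS]oq_piM.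
by apply/oq_piP/QEmulA.
Qed.

HB.instance Definition _ := GRing.Lmodule_isLalgebra.Build k Oq oq_scaleAl.

Fact oq_scaleAr (c : k) (x y : Oq) : c *: (x * y) = x * (c *: y).
Proof.
elim/oq_ind: x => a; elim/oq_ind: y => b.
rewrite -[oq_pi a * _]oq_piM -[LHS]oq_piZ -[c *: oq_pi b]oq_piZ -[RHS]oq_piM.
apply/oq_piP; apply: QEtrans (QEmulA _ _ _) _.
apply: QEtrans (QEsym (QEmulA _ _ _)).
exact: QEmul (QEcstC _ _) (QErefl _).
Qed.

HB.instance Definition _ := GRing.Lalgebra_isAlgebra.Build k Oq oq_scaleAr.

Definition oq_X (i j : 'I_n) : Oq := oq_pi (X i j).

(* The presentation of Oq, read in an arbitrary k-algebra. *)
Definition qmx_relations (B : algType k) (Y : 'I_n -> 'I_n -> B) : Prop :=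
  [/\ forall i l j : 'I_n, (i < l)%N -> Y i j * Y l j = q *: (Y l j * Y i j),
      forall i j m : 'I_n, (j < m)%N -> Y i j * Y i m = q *: (Y i m * Y i j),
      forall i l j m : 'I_n, (i < l)%N -> (m < j)%N -> Y i j * Y l m = Y l m * Y i j &
      forall i l j m : 'I_n, (i < l)%N -> (j < m)%N ->
        Y i j * Y l m - Y l m * Y i j = qhat *: (Y i m * Y l j)].

Lemma oq_X_relations : qmx_relations oq_X.
Proof.
split=> *; rewrite -?[oq_X _ _ * _]oq_piM -?[_ *: _]oq_piZ;
  rewrite -?[- oq_pi _]oq_piN -?[oq_pi _ + _]oq_piD; apply/oq_piP/QErel.
- exact: QRcol.
- exact: QRrow.
- exact: QRcomm.
- exact: QRcross.
Qed.

(* [Oq] with the family [oq_X] is universal among the k-algebras with a family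
   satisfying the relations. *)
Lemma oq_universal (B : algType k) (Y : 'I_n -> 'I_n -> B) :
  qmx_relations Y ->
  exists f : {lrmorphism Oq -> B},
    (forall i j, f (oq_X i j) = Y i j) /\
    (forall g : {lrmorphism Oq -> B},
       (forall i j, g (oq_X i j) = Y i j) -> g =1 f).
Proof.
case=> Ycol Yrow Ycomm Ycross.
have Yrel a b : qmx_rel a b -> qmx_eval Y a = qmx_eval Y b.
  case=> /= *; rewrite -?scalerAl ?mul1r.
  - exact: Ycol.
  - exact: Yrow.
  - exact: Ycomm.
  - exact: Ycross.
pose f (x : Oq) := qmx_eval Y (repr x).
have fE a : f (oq_pi a) = qmx_eval Y a by apply/qmx_eval_eq/oq_repr.
have fD : zmod_morphism f.
  elim/oq_ind=> a; elim/oq_ind=> b.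
  by rewrite -[- oq_pi b]oq_piN -[_ + _ in LHS]oq_piD !fE.
have fM : monoid_morphism f.
  split=> [|x y]; first by rewrite [LHS]fE /= scale1r.
  elim/oq_ind: x => a; elim/oq_ind: y => b.
  by rewrite -[_ * _ in LHS]oq_piM !fE.
have fZ : scalable f.
  move=> c; elim/oq_ind=> a.
  by rewrite -[_ *: _ in LHS]oq_piZ !fE /= -scalerAl mul1r.
pose F1 := GRing.isZmodMorphism.Build _ _ f fD.
pose F2 := GRing.isMonoidMorphism.Build _ _ f fM.
pose F3 := GRing.isScalable.Build _ _ _ _ f fZ.
pose F : {lrmorphism Oq -> B} := HB.pack f F1 F2 F3.
exists F; split=> [i j | g gX]; first exact: fE.
elim/oq_ind=> a; rewrite [RHS]fE.
elim: a => [i j|c|a IHa b IHb|a IHa|a IHa b IHb] /=.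
- exact: gX.
- have -> : oq_pi c%:C = c%:A.
    by rewrite -[RHS]oq_piZ; apply/oq_piP/QEsym/QEmul1r.
  by rewrite linearZ /= rmorph1.
- by rewrite -IHa -IHb oq_piD; exact: rmorphD.
- by rewrite -IHa oq_piN; exact: rmorphN.
- by rewrite -IHa -IHb oq_piM; exact: rmorphM.
Qed.

Definition perm_length (t : nat) (s : 'S_t) : nat :=
  #|[set p : 'I_t * 'I_t | (p.1 < p.2)%N && (s p.2 < s p.1)%N]|.

(* [enum I] lists the elements of I : {set 'I_n} in increasing order, see
   [sorted_enum_set].  The l-th element of J is read off as a [nth] because
   the index comes from I; the default value is never used if #|I| = #|J|. *)
Definition qminor (I J : {set 'I_n}) : Oq :=
  \sum_(s : 'S_#|I|) (- q) ^+ perm_length s *: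
    \prod_(l < #|I|) oq_X (enum_val l) (nth (enum_val l) (enum J) (s l)).

Definition qbracket (d : nat) : k :=
  \sum_(i < d) (- q) ^ (d%:Z - 1 - i%:Z *+ 2).

(* Here l is numbered from 0, so that d_l = |[1, r_l] :&: V| - l; the truncated
   subtraction is harmless, as d_l >= 1 when U >= V. *)
Definition xi_q (U V : {set 'I_n}) : k :=
  \prod_(l < #|U|)
    qbracket (#|[set v in V | (v <= (enum_val l : 'I_n))%N]| - l)%N.

End QuantumMatrices.

Section IndexSets.
Variable n : nat.
Implicit Types S T X Y I J : {set 'I_n}.

Lemma sorted_enum_set I : sorted ltn (map val (enum I)).
Proof.
rewrite sorted_map.
have tr : transitive (relpre (val : 'I_n -> nat) ltn).
  by move=> a b c /=; exact: ltn_trans.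
apply: (sorted_filter tr); rewrite -enumT -sorted_map val_enum_ord.
exact: iota_ltn_sorted.
Qed.

(* [all2] includes the equality of the two cardinals. *)
Definition leset I J : bool :=
  all2 (fun i j : 'I_n => (i <= j)%N) (enum I) (enum J).

Definition ell S T : nat :=
  #|[set p : 'I_n * 'I_n | [&& p.1 \in S, p.2 \in T & (p.2 < p.1)%N]]|.

Definition le_sets X Y : {set {set 'I_n}} :=
  [set S : {set 'I_n} |
    [&& S \subset X :|: Y, X :&: Y \subset S, #|S| == #|X| & leset S X]].

Definition ge_sets X Y : {set {set 'I_n}} :=
  [set T : {set 'I_n} |
    [&& T \subset X :|: Y, X :&: Y \subset T, #|T| == #|X| & leset X T]].

Definition natural X Y S : {set 'I_n} := (X :&: Y) :|: ((X :|: Y) :\: S).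

Definition Lexp S X Y : int :=
  (ell ((S :\: natural X Y S) :|: (Y :\: X)) (X :\: S))%:Z
  - (ell ((S :\: natural X Y S) :|: (Y :\: X)) (S :\: X))%:Z.

Definition Lexp_nat T X Y : int :=
  (ell ((natural X Y T :\: T) :|: (X :\: Y)) (T :\: X))%:Z
  - (ell ((natural X Y T :\: T) :|: (X :\: Y)) (X :\: T))%:Z.

End IndexSets.

Definition mu (k : fieldType) (n : nat) (q : k) (I M S : {set 'I_n}) : k :=
  qhat q ^+ #|S :\: I| * (- q) ^ Lexp_nat S I M * xi_q q (S :\: I) (I :\: S).

Definition lambda_tilde (k : fieldType) (n : nat) (q : k)
    (J N T : {set 'I_n}) : k :=
  (- qhat q) ^+ #|J :\: T| * (- q) ^ (- Lexp T J N)
  * xi_q q (J :\: T) (T :\: J).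

(* Main.v *)
Require Import Defs.
From HB Require Import structures.
From mathcomp Require Import all_boot all_order perm all_algebra.
From mathcomp Require Import ring zify.

(* Let E be the algebra generated by two copies e_i, f_i of the generators of
   the q-exterior algebra, braided by e_i f_i = q f_i e_i, e_i f_m = f_m e_i for
   i > m and e_i f_m = f_m e_i + qhat f_i e_m for i < m.  The elements
   y_i = sum_j X_ij e_j and z_i = sum_j X_ij f_j of Oq (x) E satisfy the same
   relations, and y_I = sum_J [I|J] e_J, z_M = sum_N [M|N] f_N.  In every algebra
   with these relations e_I f_M is a combination, with explicit scalars
   c(I,M,S), of the products f_(S natural) e_S.  Apply this to y_I z_M, expand
   everything, reorder each f_A e_T into products e_U f_V, and compare the
   coefficients of the linearly independent e_J f_N.  Reversing all products
   replaces q by q^-1 in the relations, so the coefficients of the reordering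
   f_A e_T are the c(T,A,U) at q^-1.  Columns i = 0, 1, ... of (I,M,S) form a
   lattice path, whose height is |I cap [0,i)| - |S cap [0,i)|, and c(I,M,S) is
   a product of local weights depending on the height; the bracket weights
   give xi_q.  *)

Set Implicit Arguments.
Unset Strict Implicit.
Unset Printing Implicit Defensive.

Import Order.TTheory GRing.Theory Num.Theory.
Local Open Scope ring_scope.

(** * The opposite of a k-algebra *)

Definition opp_alg (k : fieldType) (B : algType k) : Type := B.

Section OppositeAlgebra.
Variables (k : fieldType) (B : algType k).

HB.instance Definition _ := GRing.NzRing.copy (opp_alg B) (B^c).

Fact opp_scalerA (a b : k) (v : opp_alg B) :
  (a *: ((b *: (v : B)) : B) : opp_alg B) = (a * b) *: (v : B).
Proof. exact: scalerA. Qed.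

HB.instance Definition _ := GRing.Zmodule_isLmodule.Build k (opp_alg B)
  opp_scalerA (@scale1r k B) (@scalerDr k B) (fun v a b => @scalerDl k B v a b).

Fact opp_scalerAl (a : k) (x y : opp_alg B) : a *: (x * y) = (a *: x) * y.
Proof. exact: (@scalerAr k B). Qed.

HB.instance Definition _ :=
  GRing.Lmodule_isLalgebra.Build k (opp_alg B) opp_scalerAl.

Fact opp_scalerAr (a : k) (x y : opp_alg B) : a *: (x * y) = x * (a *: y).
Proof. exact: (@scalerAl k B). Qed.

HB.instance Definition _ :=
  GRing.Lalgebra_isAlgebra.Build k (opp_alg B) opp_scalerAr.

End OppositeAlgebra.

(** * Matrices over a k-algebra, as a k-algebra *)

Definition mx_alg (k : fieldType) (B : algType k) (n : nat) : Type := 'M[B]_n.+1.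

Section MatrixAlgebra.
Variables (k : fieldType) (B : algType k) (n : nat).
Local Notation MB := (mx_alg B n).

HB.instance Definition _ := GRing.NzRing.copy MB ('M[B]_n.+1).

(** The scalars are those of [k], so that [mx_alg] is an algebra over [k], although [B] need not be
    commutative. *)
Definition mx_alg_scale (c : k) (x : MB) : MB := map_mx ( *:%R c) x.

Fact mx_alg_scaleA (a b : k) (x : MB) :
  mx_alg_scale a (mx_alg_scale b x) = mx_alg_scale (a * b) x.
Proof. by apply/matrixP=> i j; rewrite !mxE scalerA. Qed.

Fact mx_alg_scale1 : left_id 1 mx_alg_scale.
Proof. by move=> x; apply/matrixP=> i j; rewrite !mxE scale1r. Qed.

Fact mx_alg_scaleDr : right_distributive mx_alg_scale +%R.
Proof. by move=> c x y; apply/matrixP=> i j; rewrite !mxE scalerDr. Qed.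

Fact mx_alg_scaleDl (x : MB) : {morph mx_alg_scale^~ x : a b / a + b}.
Proof. by move=> a b; apply/matrixP=> i j; rewrite !mxE scalerDl. Qed.

HB.instance Definition _ := GRing.Zmodule_isLmodule.Build k MB
  mx_alg_scaleA mx_alg_scale1 mx_alg_scaleDr mx_alg_scaleDl.

Fact mx_alg_scaleAl (c : k) (x y : MB) : c *: (x * y) = (c *: x) * y.
Proof.
apply/matrixP=> i j; rewrite !mxE scaler_sumr; apply: eq_bigr => l _.
by rewrite !mxE scalerAl.
Qed.

HB.instance Definition _ := GRing.Lmodule_isLalgebra.Build k MB mx_alg_scaleAl.

Fact mx_alg_scaleAr (c : k) (x y : MB) : c *: (x * y) = x * (c *: y).
Proof.
apply/matrixP=> i j; rewrite !mxE scaler_sumr; apply: eq_bigr => l _.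
by rewrite !mxE scalerAr.
Qed.

HB.instance Definition _ := GRing.Lalgebra_isAlgebra.Build k MB mx_alg_scaleAr.

Local Notation MA := (GRing.Algebra.sort (mx_alg B n : algType k)).

(** The elementary tensor of [U] and [b] in the tensor product of a matrix algebra over [k] with
    [B], realised as a matrix over [B]. *)
Definition kron (U : 'M[k]_n.+1) (b : B) : MA := \matrix_(i, j) (U i j *: b).

Lemma kronM U V a b : kron U a * kron V b = kron (U * V) (a * b).
Proof.
apply/matrixP=> i j; rewrite !mxE scaler_suml; apply: eq_bigr => l _.
by rewrite !mxE -scalerAl -scalerAr scalerA.
Qed.

Lemma kronZl c U b : c *: kron U b = kron (c *: U) b.
Proof. by apply/matrixP=> i j; rewrite !mxE scalerA. Qed.

Lemma kronZr c U b : kron U (c *: b) = kron (c *: U) b.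
Proof. by apply/matrixP=> i j; rewrite !mxE scalerA mulrC. Qed.

Lemma kronDl U V b : kron (U + V) b = kron U b + kron V b.
Proof. by apply/matrixP=> i j; rewrite !mxE scalerDl. Qed.

Lemma kronDr U a b : kron U (a + b) = kron U a + kron U b.
Proof. by apply/matrixP=> i j; rewrite !mxE scalerDr. Qed.

Lemma kron0l b : kron 0 b = 0.
Proof. by apply/matrixP=> i j; rewrite !mxE scale0r. Qed.

Lemma kron0r U : kron U 0 = 0.
Proof. by apply/matrixP=> i j; rewrite !mxE scaler0. Qed.

End MatrixAlgebra.

(** * Braided pairs of q-exterior generators; the rank [r] lets the index type be [nat] or ['I_n] *)

Record braided (k : fieldType) (q : k) (T : Type) (r : T -> nat)
    (B : algType k) (e f : T -> B) : Prop := Braided {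
  br_ee i : e i * e i = 0;
  br_ff i : f i * f i = 0;
  br_e i l : (r i < r l)%N -> e l * e i = - q *: (e i * e l);
  br_f i l : (r i < r l)%N -> f l * f i = - q *: (f i * f l);
  br_efii i : e i * f i = q *: (f i * e i);
  br_ef_gt i m : (r m < r i)%N -> e i * f m = f m * e i;
  br_ef_lt i m : (r i < r m)%N ->
    e i * f m = f m * e i + qhat q *: (f i * e m) }.

Lemma qhatV (k : fieldType) (q : k) : qhat q^-1 = - qhat q.
Proof. by rewrite /qhat invrK opprB. Qed.

(** Each relation, solved for the product in the other order, is the same relation with [q^-1], read
    in the reversed algebra. *)
Lemma braided_opp (k : fieldType) (q : k) (T : Type) (r : T -> nat)
    (B : algType k) (e f : T -> B) : q != 0 ->
  braided q r e f -> @braided k q^-1 T r (opp_alg B) e f.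
Proof.
move=> q0 [ee ff he hf efii ef_gt ef_lt].
(* The correction term [f i * e m] of the braiding equals [e m * f i], because [m] has the larger
   rank. *)
have lt (i m : T) : (r i < r m)%N -> f m * e i = e i * f m - qhat q *: (e m * f i).
  by move=> im; rewrite ef_lt // (ef_gt m i) // addrK.
split=> [//|//|i l il|i l il|i|i m mi|i m im].
- suff: e i * e l = - q^-1 *: (e l * e i) by [].
  by rewrite (he i l) // scalerA mulrNN mulVf // scale1r.
- suff: f i * f l = - q^-1 *: (f l * f i) by [].
  by rewrite (hf i l) // scalerA mulrNN mulVf // scale1r.
- suff: f i * e i = q^-1 *: (e i * f i) by [].
  by rewrite efii scalerA mulVf // scale1r.
- suff: f m * e i = e i * f m by [].
  by rewrite ef_gt.
- suff: f m * e i = e i * f m + qhat q^-1 *: (e m * f i) by [].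
  by rewrite lt // qhatV scaleNr.
Qed.

(** * Matrices acting on the algebra of a single column *)

Section ColumnMatrices.
Variables (k : fieldType) (q : k).
Hypothesis q0 : q != 0.

Definition mx4 (s : seq (seq k)) : 'M[k]_4 :=
  \matrix_(i, j) nth 0 (nth [::] s i) j.

(* Matrices on the algebra of one column, in its basis 1, e, f, ef: E and F are
   the left multiplications by e and f; when a later column e', f' is added, e'
   acts as A (x) e' and f' as D (x) f' + C (x) e'. *)
Definition fockE := mx4 [:: [:: 0; 0; 0; 0]; [:: 1; 0; 0; 0];
                           [:: 0; 0; 0; 0]; [:: 0; 0; 1; 0]].
Definition fockF := mx4 [:: [:: 0; 0; 0; 0]; [:: 0; 0; 0; 0];
                           [:: 1; 0; 0; 0]; [:: 0; q^-1; 0; 0]].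
Definition fockA := mx4 [:: [:: 1; 0; 0; 0]; [:: 0; - q; 0; 0];
                           [:: 0; 0; 1; 0]; [:: 0; 0; 0; - q]].
Definition fockD := mx4 [:: [:: 1; 0; 0; 0]; [:: 0; 1; 0; 0];
                           [:: 0; 0; - q; 0]; [:: 0; 0; 0; - q]].
Definition fockC := mx4 [:: [:: 0; 0; 0; 0]; [:: 0; 0; 0; 0];
                           [:: 0; - qhat q; 0; 0]; [:: 0; 0; 0; 0]].

(** With the product computed on lists of rows, every matrix relation below splits into scalar
    identities that [field] can settle. *)
Lemma mx4M (s t : seq (seq k)) : mx4 s * mx4 t =
  mx4 [seq [seq nth 0 (nth [::] s i) 0 * nth 0 (nth [::] t 0) j
              + nth 0 (nth [::] s i) 1 * nth 0 (nth [::] t 1) j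
              + nth 0 (nth [::] s i) 2 * nth 0 (nth [::] t 2) j
              + nth 0 (nth [::] s i) 3 * nth 0 (nth [::] t 3) j
            | j <- iota 0 4] | i <- iota 0 4].
Proof.
apply/matrixP=> i j; rewrite !mxE !big_ord_recr big_ord0 /= !mxE add0r.
by case: i j => [[|[|[|[|?]]]] ?] [[|[|[|[|?]]]] ?].
Qed.

Ltac mx4_solve :=
  rewrite ?mx4M /=; apply/matrixP=> [[[|[|[|[|?]]]] ?] [[|[|[|[|?]]]] ?]];
  rewrite ?mxE //= /qhat; try by field.

(** This relation and those that follow are what [braided_cons] needs: some express the braiding
    within a column, the others make the twists [fockA], [fockD], [fockC] compatible with it and
    with each other. *)
Lemma fockEE : fockE * fockE = 0. Proof. by mx4_solve. Qed.
Lemma fockFF : fockF * fockF = 0. Proof. by mx4_solve. Qed.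
Lemma fockEF : fockE * fockF = q *: (fockF * fockE). Proof. by mx4_solve. Qed.
Lemma fockAE : fockA * fockE = - q *: (fockE * fockA). Proof. by mx4_solve. Qed.
Lemma fockAF : fockA * fockF = fockF * fockA. Proof. by mx4_solve. Qed.
Lemma fockDE : fockD * fockE = fockE * fockD. Proof. by mx4_solve. Qed.
Lemma fockDF : fockD * fockF = - q *: (fockF * fockD). Proof. by mx4_solve. Qed.
Lemma fockCF : fockC * fockF = - q *: (fockF * fockC). Proof. by mx4_solve. Qed.
Lemma fockEC : fockE * fockC = fockC * fockE + qhat q *: (fockF * fockA).
Proof. by mx4_solve. Qed.
Lemma fockDA : fockD * fockA = fockA * fockD. Proof. by mx4_solve. Qed.
Lemma fockDC : fockD * fockC = - q *: (fockC * fockD). Proof. by mx4_solve. Qed.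
Lemma fockCA : fockC * fockA = - q *: (fockA * fockC). Proof. by mx4_solve. Qed.

End ColumnMatrices.

(** * Scalar matrices and matrix entries *)

Section ScalarMatrices.
Variables (k : fieldType) (B : algType k) (n : nat).

Definition mx_scalar (b : B) : mx_alg B n := (b%:M : 'M_n.+1).
Definition mx_entry (i j : 'I_n.+1) (x : mx_alg B n) : B := (x : 'M_n.+1) i j.

Fact mx_scalar_is_zmod_morphism : zmod_morphism mx_scalar.
Proof. by move=> a b; apply: (raddfB (@scalar_mx B n.+1)). Qed.
Fact mx_scalar_is_monoid_morphism : monoid_morphism mx_scalar.
Proof. by split=> [//|a b]; apply: (scalar_mxM n.+1). Qed.
Fact mx_scalar_is_scalable : scalable mx_scalar.
Proof. by move=> c b; apply/matrixP=> i j; rewrite !mxE -scalerMnr. Qed.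
HB.instance Definition _ :=
  GRing.isZmodMorphism.Build _ _ mx_scalar mx_scalar_is_zmod_morphism.
HB.instance Definition _ :=
  GRing.isMonoidMorphism.Build _ _ mx_scalar mx_scalar_is_monoid_morphism.
HB.instance Definition _ :=
  GRing.isScalable.Build _ _ _ _ mx_scalar mx_scalar_is_scalable.

Fact mx_entry_is_zmod_morphism i j : zmod_morphism (mx_entry i j).
Proof. by move=> x y; rewrite /mx_entry !mxE. Qed.
HB.instance Definition _ i j :=
  GRing.isZmodMorphism.Build _ _ (mx_entry i j) (mx_entry_is_zmod_morphism i j).

Lemma mx_scalar_kron a U b : mx_scalar a * kron U b = kron U (a * b).
Proof. by rewrite /mx_scalar [LHS]mul_scalar_mx; apply/matrixP=> i j; rewrite !mxE scalerAr. Qed.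

Lemma kron_mx_scalar a U b : a * b = b * a -> GRing.comm (mx_scalar a) (kron U b).
Proof.
move=> ab; rewrite /GRing.comm mx_scalar_kron ab; apply/matrixP=> i j.
rewrite !mxE (bigD1 j) //= big1 ?addr0 => [|l /negPf lj]; rewrite !mxE ?eqxx ?lj ?mulr0 //.
by rewrite mulr1n scalerAl.
Qed.

Lemma mx_entry_scalar i j a x : mx_entry i j (mx_scalar a * x) = a * mx_entry i j x.
Proof. by rewrite /mx_entry /mx_scalar [_ * x]mul_scalar_mx !mxE. Qed.

End ScalarMatrices.

(** * Construction of the braided algebra, one column at a time *)

Section Fock.
Variables (k : fieldType) (q : k).
Hypothesis q0 : q != 0.

Lemma mulr_sub_qhat : q * (q - qhat q) = 1.
Proof. by rewrite /qhat opprB addrC subrK divff. Qed.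

Definition scons (B : Type) (x : B) (g : nat -> B) (i : nat) : B :=
  if i is j.+1 then g j else x.

(** The new column gets index 0 and the old ones are shifted. Relations that involve column 0 come
    from those of the column matrices; relations between two later columns combine the old braiding
    with the commutation rules of [fockA], [fockD] and [fockC]. *)
Lemma braided_cons (B : algType k) (e f : nat -> B) : braided q id e f ->
  braided q id
    (scons (kron (@fockE k) 1 : mx_alg B 3) (fun i => kron (fockA q) (e i)))
    (scons (kron (fockF q) 1 : mx_alg B 3)
       (fun i => kron (fockD q) (f i) + kron (fockC q) (e i))).
Proof.
case=> ee ff he hf efii ef_gt ef_lt; split.
- by case=> [|i] /=; rewrite kronM ?ee ?kron0r // fockEE kron0l.
- case=> [|i] /=; first by rewrite kronM fockFF // kron0l.
  rewrite mulrDl !mulrDr !kronM ff ee !kron0r add0r addr0.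
  by rewrite efii kronZr -kronDl fockDC // scaleNr addNr kron0l.
- case=> [|i] [|l] //= il; rewrite !kronM. rewrite ?kronZl.
    by rewrite mulr1 mul1r fockAE //.
  by rewrite he // kronZr kronZl.
- case=> [|i] [|l] //= il.
    by rewrite mulrDl mulrDr !kronM mulr1 mul1r fockDF // fockCF // -!kronZl mulr1 mul1r scalerDr.
  rewrite !mulrDl !mulrDr !kronM hf // he // ef_gt // (ef_lt i l) // !kronZr.
  rewrite fockDC // kronDr kronZr -!kronZl.
  rewrite !scalerDr !scalerA; set u := kron _ (f i * e l).
  (* The coefficient 1 of [u] is split as q^2 - q qhat, to match the two contributions on the other
     side. *)
  have {1}-> : u = (- q * - q) *: u + (- q * qhat q) *: u.
    by rewrite -scalerDl -mulrDr mulNr -mulrN opprD opprK mulr_sub_qhat scale1r.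
  by rewrite -!addrA; congr (_ + _); rewrite addrCA.
- case=> [|i] /=; first by rewrite !kronM fockEF // mulr1 -kronZl.
  rewrite mulrDl mulrDr !kronM ee !kron0r !addr0 efii kronZr fockDA //.
  by rewrite kronZl.
- case=> [|i] [|m] //= mi; first by rewrite !kronM fockAF // mulr1 mul1r.
  rewrite mulrDl mulrDr !kronM ef_gt // fockDA // he // kronZr fockCA //.
- case=> [|i] [|m] //= im.
    rewrite mulrDl mulrDr !kronM !mulr1 !mul1r fockEC // fockDE // kronDl.
    by rewrite -kronZl addrA.
  rewrite !mulrDl !mulrDr !kronM ef_lt // (he i m) // fockDA // fockCA //.
  rewrite !kronDr !kronZr -!kronZl !scalerDr !scalerA -!addrA.
  set w := kron _ (e i * e m); set u := kron _ (f i * e m).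
  congr (_ + _); rewrite addrCA; congr (_ + _).
  rewrite -scalerDl -mulrDl mulrC mulNr -mulrN opprD opprK mulr_sub_qhat.
  by rewrite scale1r.
Qed.

(** Sets of columns are predicates on [nat] here, so that removing column 0 is a shift of the
    index. *)
Definition masked_prod (B : algType k) n (J : nat -> bool) (e : nat -> B) : B :=
  \prod_(i < n | J i) e i.

(** The position of e^b f^c in the basis 1, e, f, ef of one column. *)
Definition fock_state (b c : bool) : 'I_4 := inord (b + c.*2).

Lemma masked_prod_cons (B : algType k) n (J : nat -> bool) (e : nat -> B) x :
  masked_prod n.+1 J (scons x e) =
  (if J 0%N then x else 1) * masked_prod n (fun i => J i.+1) e.
Proof.
rewrite /masked_prod big_mkcond big_ord_recl -big_mkcond /=.
by case: (J 0%N); rewrite ?mul1r.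
Qed.

Section ColumnMaps.
Variable B : algType k.
Implicit Types (x y : mx_alg B 3) (s t u : 'I_4).

(** Says that [x] sends the basis vector [s] to [b] times the basis vector [t]. *)
Definition maps_col s t x (b : B) :=
  forall l, mx_entry l s x = if l == t then b else 0.

Lemma maps_col1 s : maps_col s s 1 1.
Proof. by move=> l; rewrite /mx_entry mxE; case: eqP. Qed.

Lemma maps_colM s t u x y b c :
  maps_col s t x b -> maps_col t u y c -> maps_col s u (y * x) (c * b).
Proof.
move=> xst ytu l; rewrite /mx_entry [LHS]mxE (bigD1 t) //= big1 => [|j /negPf jt].
  by rewrite -[_ t s]/(mx_entry t s x) -[_ l t]/(mx_entry l t y) xst ytu eqxx addr0;
    case: eqP; rewrite ?mul0r.
by rewrite -[_ j s]/(mx_entry j s x) xst jt mulr0.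
Qed.

Lemma maps_col_prod s n (J : nat -> bool) (x : nat -> mx_alg B 3) b :
  (forall i, maps_col s s (x i) (b i)) ->
  maps_col s s (masked_prod n J x) (masked_prod n J b).
Proof.
move=> xb; apply: (big_rec2 (fun x b => maps_col s s x b)) => [|i c y _ IH].
  exact: maps_col1.
exact: maps_colM IH (xb i).
Qed.

Lemma maps_col_kron s t (U : 'M[k]_4) (b : B) : (forall l, U l s = (l == t)%:R) ->
  maps_col s t (kron U b) b.
Proof.
by move=> Ust l; rewrite /mx_entry mxE Ust; case: eqP => _; rewrite ?scale1r ?scale0r.
Qed.

End ColumnMaps.

Lemma fock_state_inj a b c d : (fock_state a b == fock_state c d) = (a == c) && (b == d).
Proof. by rewrite -val_eqE /fock_state /= !inordK; case: a b c d => [] [] [] []. Qed.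

Variable A : algType k.
(** Induction on the number of columns. The functional [phi J N] lets the operator act on the basis
    vector 1 of the first column (matrix column 0), keeps the row given by the membership of that
    column in [J] and [N], and applies the previous functional to this entry. *)
Lemma fock_space (n : nat) : exists (B : algType k) (iota : {lrmorphism A -> B})
    (e f : nat -> B) (phi : (nat -> bool) -> (nat -> bool) -> {additive B -> A}),
  [/\ braided q id e f,
      (forall a i, GRing.comm (iota a) (e i)) /\ (forall a i, GRing.comm (iota a) (f i)),
      forall J N a x, phi J N (iota a * x) = a * phi J N x &
      forall J N J' N', phi J N (masked_prod n J' e * masked_prod n N' f) =
        [forall i : 'I_n, (J i == J' i) && (N i == N' i)]%:R].
Proof.
elim: n => [|n [B [iota [e [f [phi [br [ce cf] phiM phi_dual]]]]]]].
  (* Without columns all generators may be zero, which satisfies every relation. *)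
  exists A, idfun, (fun=> 0), (fun=> 0), (fun _ _ => idfun); split=> //.
  - by split=> *; rewrite ?mulr0 ?scaler0 ?addr0.
  - by split=> *; rewrite /GRing.comm mulr0 mul0r.
  - move=> J N J' N'; rewrite /masked_prod !big_ord0 mulr1 /=.
    by case: forallP => // -[] [].
pose J1 (J : nat -> bool) i := J i.+1.
exists (mx_alg B 3), (@mx_scalar k B 3 \o iota).
exists (scons (kron (@fockE k) 1 : mx_alg B 3) (fun i => kron (fockA q) (e i))).
exists (scons (kron (fockF q) 1 : mx_alg B 3)
       (fun i => kron (fockD q) (f i) + kron (fockC q) (e i))).
exists (fun J N => phi (J1 J) (J1 N) \o @mx_entry k B 3 (fock_state (J 0%N) (N 0%N)) 0).
split.
- exact: braided_cons.
- split=> a [|i] /=; try apply: commrD; apply: kron_mx_scalar; rewrite ?mulr1 ?mul1r //;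
  solve [exact: ce|exact: cf].
- by move=> J N a x /=; rewrite mx_entry_scalar phiM.
- move=> J N J' N' /=; rewrite !masked_prod_cons.
  set J1' := fun i => J' i.+1; set N1' := fun i => N' i.+1.
  set x := _ * _.
  have xmap : maps_col 0 (fock_state (J' 0%N) (N' 0%N)) x
      (masked_prod n J1' e * masked_prod n N1' f).
    (* Acting on the vector 1, the later f's fix it, the first f may move it to the state [s], the
       later e's fix [s], and the first e may move [s] to the final state. *)
    pose s := fock_state false (N' 0%N).
    have -> : masked_prod n J1' e * masked_prod n N1' f =
      (1 * masked_prod n J1' e) * (1 * masked_prod n N1' f) by rewrite !mul1r.
    apply: (@maps_colM _ _ s); [apply: (@maps_colM _ _ 0) | apply: (@maps_colM _ _ s)].
    + apply: maps_col_prod => i l; rewrite /mx_entry !mxE.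
      by case: l => [[|[|[|[|?]]]] ?] //=; rewrite ?scale0r ?scale1r ?addr0.
    + rewrite /s; case: (N' 0%N); last first.
        have -> : fock_state false false = 0 by apply: val_inj; rewrite /= inordK.
        exact: maps_col1.
      apply: maps_col_kron => l; rewrite mxE -val_eqE /= inordK //.
      by case: l => [[|[|[|[|?]]]] ?].
    + apply: maps_col_prod => i; apply: maps_col_kron => l.
      rewrite mxE -val_eqE /s /= inordK; last by case: (N' _).
      by case: (N' 0%N); case: l => [[|[|[|[|?]]]] ?].
    + rewrite /s; case: (J' 0%N); last exact: maps_col1.
      apply: maps_col_kron => l; rewrite mxE -!val_eqE /= !inordK; try by case: (N' _).
      by case: (N' 0%N); case: l => [[|[|[|[|?]]]] ?].
  rewrite xmap fock_state_inj; case: eqP => [J0|J0] /=; last first.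
    rewrite raddf0; case: forallP => // /(_ ord0) /andP[/eqP]; by [].
  case: eqP => [N0|N0] /=; last first.
    rewrite raddf0; case: forallP => // /(_ ord0) /andP[_ /eqP]; by [].
  rewrite phi_dual; congr (_%:R); congr nat_of_bool.
  apply/forallP/forallP => H i; last exact: (H (lift ord0 i)).
  case: (unliftP ord0 i) => [j|] ->; first exact: (H j).
  by rewrite /= J0 N0 !eqxx.
Qed.
End Fock.

(** * Increasing enumerations and initial segments of index sets *)

Section IndexSets.
Variable n : nat.
Implicit Types (S T : {set 'I_n}) (i x t m : 'I_n).

Definition ord_lt : rel 'I_n := fun i j => (i < j)%N.

Lemma ord_lt_trans : transitive ord_lt.
Proof. by move=> b a c; apply: ltn_trans. Qed.

Lemma enum_sorted S : sorted ord_lt (enum S).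
Proof. by have := sorted_enum_set S; rewrite sorted_map. Qed.

Lemma enum_sorted_eq S (s : seq 'I_n) : sorted ord_lt s -> s =i S -> enum S = s.
Proof.
move=> sorted_s sS; apply: (irr_sorted_eq ord_lt_trans) => //.
- by move=> i; rewrite /ord_lt ltnn.
- exact: enum_sorted.
- by move=> i; rewrite mem_enum sS.
Qed.

Definition below S (t : nat) : {set 'I_n} := [set i in S | (i < t)%N].
Definition above S (t : nat) : {set 'I_n} := [set i in S | (t < i)%N].

Lemma ord_lt_sorted_cat (s1 s2 : seq 'I_n) : sorted ord_lt s1 -> sorted ord_lt s2 ->
  {in s1 & s2, forall i j : 'I_n, (i < j)%N} -> sorted ord_lt (s1 ++ s2).
Proof.
rewrite !(sorted_pairwise ord_lt_trans) pairwise_cat => -> -> H.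
by rewrite !andbT; apply/allrelP.
Qed.

Lemma enum_cat S T : {in S & T, forall i j : 'I_n, (i < j)%N} ->
  enum (S :|: T) = enum S ++ enum T.
Proof.
move=> ST; apply: enum_sorted_eq => [|i]; last by rewrite mem_cat !mem_enum inE.
apply: ord_lt_sorted_cat; try exact: enum_sorted.
by move=> i j; rewrite !mem_enum; apply: ST.
Qed.

Lemma enum_split S t : enum S =
  enum (below S t) ++ (if t \in S then [:: t] else [::]) ++ enum (above S t).
Proof.
apply: enum_sorted_eq => [|i].
  apply: ord_lt_sorted_cat; first exact: enum_sorted.
    apply: ord_lt_sorted_cat; try exact: enum_sorted; first by case: ifP.
    by move=> i j; case: ifP => // tS; rewrite !inE => /eqP ->; rewrite mem_enum inE => /andP[].
  move=> i j; rewrite mem_enum mem_cat mem_enum !inE => /andP[_ it].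
  case: (t \in S); rewrite ?inE; first case/orP=> [/eqP->//|].
    by case/andP=> _; apply: ltn_trans.
  by case/andP=> _; apply: ltn_trans.
rewrite !mem_cat !mem_enum !inE.
case: (ltngtP i t) => [it|it|/val_inj ->]; rewrite ?andbT ?andbF ?orbF /=.
- by case: ifP; rewrite ?inE ?orbF // => _; case: eqP it => [->|]; rewrite ?ltnn ?orbF.
- by case: ifP; rewrite ?inE ?orbF // => _; case: eqP it => [->|]; rewrite ?ltnn ?orbF.
- by case: ifP; rewrite ?inE ?eqxx.
Qed.

Lemma set_max_ind (P : {set 'I_n} -> Prop) : P set0 ->
  (forall t S, (forall i, i \in S -> (i < t)%N) -> P S -> P (t |: S)) ->
  forall S, P S.
Proof.
move=> P0 PS S; have [c] := ubnP #|S|; elim: c S => // c IH S.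
have [->//|[i0 i0S]] := set_0Vmem S; rewrite ltnS => cS.
pose t := [arg max_(i > i0 in S) (i : nat)].
have [tS tmax] : t \in S /\ forall i, i \in S -> (i <= t)%N.
  by rewrite /t; case: arg_maxnP.
rewrite -(setD1K tS); apply: PS => [i|].
  by rewrite !inE => /andP[it /tmax]; rewrite leq_eqVlt (inj_eq val_inj) (negPf it).
by apply: IH; rewrite (cardsD1 t) tS in cS.
Qed.

End IndexSets.

(** * Ordered products of q-exterior generators *)

Section OrderedProducts.
Variables (k : fieldType) (q : k) (n : nat) (B : algType k).
Implicit Types (e f : 'I_n -> B) (S T I M : {set 'I_n}) (i t m : 'I_n).

Definition oprod e S : B := \prod_(i <- enum S) e i.

Lemma oprod0 e : oprod e set0 = 1.
Proof. by rewrite /oprod enum_set0 big_nil. Qed.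

Lemma oprod1 e t : oprod e [set t] = e t.
Proof. by rewrite /oprod enum_set1 big_seq1. Qed.

Lemma oprod_cat e S T : {in S & T, forall i j : 'I_n, (i < j)%N} ->
  oprod e (S :|: T) = oprod e S * oprod e T.
Proof. by move=> ST; rewrite /oprod enum_cat // big_cat. Qed.

Lemma oprod_max e S t : (forall i, i \in S -> (i < t)%N) ->
  oprod e (t |: S) = oprod e S * e t.
Proof.
move=> St; rewrite setUC oprod_cat ?oprod1 // => i j iS.
by rewrite inE => /eqP ->; apply: St.
Qed.

Lemma oprod_split e S t : oprod e S =
  oprod e (below S t) * (if t \in S then e t else 1) * oprod e (above S t).
Proof.
rewrite {1}/oprod (enum_split S t) !big_cat /= mulrA; congr (_ * _ * _).
by case: ifP; rewrite ?big_seq1 ?big_nil.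
Qed.

Definition q_exterior e := (forall i, e i * e i = 0) /\
  forall i l : 'I_n, (i < l)%N -> e l * e i = - q *: (e i * e l).

Lemma comm_scale_prod (x : B) e c (s : seq 'I_n) :
  (forall i, i \in s -> x * e i = c *: (e i * x)) ->
  x * (\prod_(i <- s) e i) = c ^+ size s *: ((\prod_(i <- s) e i) * x).
Proof.
elim: s => [|i s IH] H; first by rewrite big_nil mul1r mulr1 scale1r.
rewrite !big_cons mulrA H ?inE ?eqxx // -scalerAl -[e i * x * _]mulrA IH; last first.
  by move=> j js; apply: H; rewrite inE js orbT.
by rewrite -scalerAr scalerA mulrA -exprS.
Qed.

Section Insertion.
Variable e : 'I_n -> B.
Hypothesis ext_e : q_exterior e.

Lemma gen_oprod_below S t :
  e t * oprod e (below S t) = (- q) ^+ #|below S t| *: (oprod e (below S t) * e t).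
Proof.
case: ext_e => _ he; rewrite /oprod cardE; apply: comm_scale_prod => i.
by rewrite mem_enum inE => /andP[_]; apply: he.
Qed.

Lemma oprod_above_gen S t :
  oprod e (above S t) * e t = (- q) ^+ #|above S t| *: (e t * oprod e (above S t)).
Proof.
case: ext_e => _ he; rewrite /oprod cardE.
have : forall i, i \in enum (above S t) -> (t < i)%N.
  by move=> i; rewrite mem_enum inE => /andP[].
elim: (enum _) => [|i s IH] H; first by rewrite !big_nil mulr1 mul1r scale1r.
rewrite !big_cons -mulrA IH; last by move=> j js; apply: H; rewrite inE js orbT.
rewrite -scalerAr [e i * (e t * _)]mulrA (he t i); last by apply: H; rewrite inE eqxx.
by rewrite -scalerAl scalerA -mulrA -exprSr.
Qed.

Lemma belowU1 S t : below (t |: S) t = below S t.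
Proof. by apply/setP=> i; rewrite !inE; case: eqP => // ->; rewrite ltnn !andbF. Qed.

Lemma aboveU1 S t : above (t |: S) t = above S t.
Proof. by apply/setP=> i; rewrite !inE; case: eqP => // ->; rewrite ltnn !andbF. Qed.

(** The generator passes every smaller element of [S] at the cost of a factor -q, and then either
    meets its own copy, whose square is zero, or stands in its place. *)
Lemma gen_oprod S t : e t * oprod e S =
  if t \in S then 0 else (- q) ^+ #|below S t| *: oprod e (t |: S).
Proof.
rewrite (oprod_split e S t) !mulrA gen_oprod_below -!scalerAl.
case: ifP => tS; first by rewrite -[_ * _ * e t]mulrA ext_e.1 mulr0 mul0r scaler0.
by rewrite (oprod_split e (t |: S) t) belowU1 aboveU1 inE set11 mulr1.
Qed.

Lemma oprod_gen S t : oprod e S * e t =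
  if t \in S then 0 else (- q) ^+ #|above S t| *: oprod e (t |: S).
Proof.
rewrite (oprod_split e S t) -!mulrA oprod_above_gen.
case: ifP => tS.
  by rewrite -!scalerAr [e t * (e t * _)]mulrA ext_e.1 mul0r mulr0 scaler0.
by rewrite (oprod_split e (t |: S) t) belowU1 aboveU1 inE set11 mul1r -!scalerAr mulrA.
Qed.

End Insertion.

Section Exchange.
Variables e f : 'I_n -> B.
Hypothesis q0 : q != 0.
Hypothesis br : braided q val e f.

Lemma braided_ext_e : q_exterior e.
Proof. by case: br => ee ff he *; split. Qed.

Lemma braided_ext_f : q_exterior f.
Proof. by case: br => ee ff he hf *; split. Qed.

Lemma oprod_exchange_gt S m : (forall i, i \in S -> (i < m)%N) ->
  e m * oprod f S = oprod f S * e m.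
Proof.
move=> Sm; have := @comm_scale_prod (e m) f 1 (enum S) _.
rewrite expr1n !scale1r; apply=> i; rewrite mem_enum => /Sm im.
by rewrite scale1r (br_ef_gt br).
Qed.

(** Induction on the greatest element of [S]: one step of the braiding either lets [f m] pass or
    exchanges indices, and in the latter case the new [f] has to travel further left. *)
Lemma oprod_exchange S m : (forall i, i \in S -> (i < m)%N) ->
  oprod e S * f m = f m * oprod e S + qhat q *:
    \sum_(s in S) (- q) ^- #|above S s| *: (f s * oprod e (S :\ s) * e m).
Proof.
elim/set_max_ind: S m => [|t S St IH] m Sm.
  by rewrite big_set0 scaler0 addr0 oprod0 mul1r mulr1.
have Sm' i : i \in S -> (i < m)%N by move=> iS; apply: Sm; rewrite inE iS orbT.
have tm : (t < m)%N by apply: Sm; rewrite inE set11.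
have tS : t \notin S by apply/negP => /St; rewrite ltnn.
rewrite oprod_max // -mulrA (br_ef_lt br tm) mulrDr !mulrA (IH m) //.
rewrite -scalerAr !mulrA (IH t) // big_setU1 //=.
have -> : above (t |: S) t = set0.
  apply/setP=> i; rewrite !inE; apply/negP => /andP[/orP[/eqP->|/St]].
    by rewrite ltnn.
  by case: ltngtP.
rewrite cards0 expr0 invr1 scale1r setU1K //.
rewrite !mulrDl -!addrA; congr (_ + _).
rewrite -scalerAl -scalerDr addrCA; congr (_ *: (_ + _)).
rewrite -scalerAl !mulr_suml scaler_sumr -big_split; apply: eq_bigr => s sS /=.
have st : (s < t)%N by exact: St.
have -> : above (t |: S) s = t |: above S s.
  by apply/setP=> i; rewrite !inE; case: eqP => [->|//]; rewrite st.
have -> : (t |: S) :\ s = t |: (S :\ s).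
  by apply/setP=> i; rewrite !inE; case: eqP => [->|//]; case: eqP st => // ->; rewrite ltnn.
rewrite oprod_max => [|i]; last by rewrite inE => /andP[_]; apply: St.
rewrite cardsU1 inE (negPf tS) /= -!scalerAl -!mulrA.
(* Both contributions contain [f s]; they add up since -q + qhat = (-q)^-1, which records the new
   element [t] above [s]. *)
rewrite (br_e br (i := t) (l := m)) // -!scalerAr !scalerA -scalerDl.
congr (_ *: _); rewrite /qhat exprS; field.
by rewrite expf_neq0 ?oppr_eq0 // q0.
Qed.

End Exchange.
End OrderedProducts.

(** * Prefix products and Abel summation *)

Section PrefixProducts.
Variables (k : fieldType) (n : nat).
Implicit Types (w v : 'I_n -> k).

Lemma big_ord_ltS (R : Type) (idx : R) (op : Monoid.com_law idx) t (tn : (t < n)%N)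
    (P : pred 'I_n) (F : 'I_n -> R) :
  \big[op/idx]_(x < n | P x && (x < t.+1)%N) F x =
  op (if P (Ordinal tn) then F (Ordinal tn) else idx)
     (\big[op/idx]_(x < n | P x && (x < t)%N) F x).
Proof.
rewrite big_mkcondl [in RHS]big_mkcondl (bigD1 (Ordinal tn)) //=.
congr (op _ _); apply: eq_bigl => x.
by rewrite ltnS leq_eqVlt -val_eqE /=; case: ltngtP; rewrite ?andbF.
Qed.

(* Abel summation: [v s] is, up to the prefix product, the difference of
   [b s * w' s] and [w s * b s.+1]. *)
Lemma telescope_prod w v (w' : 'I_n -> k) (b : nat -> k) :
  (forall s : 'I_n, (\prod_(x < n | (x < s)%N) w x) *
     (w s * b s.+1 + v s - b s * w' s) = 0) ->
  \sum_(s < n) (\prod_(x < n | (x < s)%N) w x) * v s * \prod_(x < n | (s < x)%N) w' x =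
  b 0%N * \prod_x w' x - b n * \prod_x w x.
Proof.
move=> H.
have {H} : forall t, (t <= n)%N ->
  \sum_(s < n | true && (s < t)%N) (\prod_(x < n | (x < s)%N) w x) * v s
     * (\prod_(x < n | (s < x)%N && (x < t)%N) w' x) =
  b 0%N * \prod_(x < n | true && (x < t)%N) w' x - b t * \prod_(x < n | true && (x < t)%N) w x.
  elim=> [|t IH] tn.
    by rewrite !big_pred0 ?mulr1 ?subrr // => x; rewrite ltn0 andbF.
  have E0 : \prod_(x < n | (t < x)%N && (x < t.+1)%N) w' x = 1.
    by rewrite big_pred0 // => x; rewrite ltnS; case: ltngtP.
  rewrite ![in RHS](big_ord_ltS _ tn) [LHS](big_ord_ltS _ tn) /= E0 mulr1.
  rewrite [X in _ + X](_ : _ = (b 0%N * \prod_(x < n | true && (x < t)%N) w' x -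
      b t * \prod_(x < n | true && (x < t)%N) w x) * w' (Ordinal tn)); last first.
    rewrite -(IH (ltnW tn)) mulr_suml; apply: eq_bigr => s st.
    by rewrite (big_ord_ltS _ tn) /= st; ring.
  have := H (Ordinal tn); rewrite /=.
  set W := \prod_(x < n | _) w x => HW.
  by apply/eqP; rewrite -subr_eq0 -HW; apply/eqP; ring.
move/(_ n (leqnn n)).
have E (F : 'I_n -> k) : \prod_(x < n | true && (x < n)%N) F x = \prod_x F x.
  by apply: eq_bigl => x; rewrite ltn_ord.
rewrite !E => <-; apply: eq_big => [s|s _]; first by rewrite ltn_ord.
by congr (_ * _); apply: eq_bigl => x; rewrite ltn_ord andbT.
Qed.

Lemma prod_split_at (F : 'I_n -> k) (s : 'I_n) : \prod_x F x =
  (\prod_(x < n | (x < s)%N) F x) * F s * \prod_(x < n | (s < x)%N) F x.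
Proof.
rewrite (bigD1 s) //= (bigID (fun x : 'I_n => (x < s)%N)) /= mulrA [_ * F s]mulrC.
by congr (_ * _ * _); apply: eq_bigl => x; rewrite -val_eqE /=; case: ltngtP.
Qed.

Lemma card_below_S (S : {set 'I_n}) t (tn : (t < n)%N) :
  #|below S t.+1| = (#|below S t| + (Ordinal tn \in S))%N.
Proof.
by rewrite -!sum1dep_card (big_ord_ltS _ tn) /= addnC; congr (_ + _)%N.
Qed.

Lemma below_full (S : {set 'I_n}) : below S n = S.
Proof. by apply/setP=> x; rewrite inE ltn_ord andbT. Qed.

Lemma prod_if_above (p : k) (S : {set 'I_n}) (s : 'I_n) :
  \prod_(x < n | (s < x)%N) (if x \in S then p else 1) = p ^+ #|above S s|.
Proof.
rewrite -big_mkcondr /= -prodr_const; apply: eq_bigl => x.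
by rewrite inE andbC.
Qed.

End PrefixProducts.

(** * Weights of lattice paths and the summation identity *)

Section Weights.
Variables (k : fieldType) (q : k) (n : nat).
Hypothesis q0 : q != 0.
Implicit Types (I M S : {set 'I_n}) (h : int).

Let p0 : - q != 0. Proof. by rewrite oppr_eq0. Qed.

Lemma qbracketS d : qbracket q d.+1 = - q * qbracket q d + (- q) ^- d.
Proof.
rewrite /qbracket big_ord_recr /= mulr_sumr; congr (_ + _).
  apply: eq_bigr => i _; rewrite -{2}[- q]expr1z -expfzDr //; congr (_ ^ _); lia.
by rewrite exprnN; congr (_ ^ _); lia.
Qed.

Lemma qbracket0 : qbracket q 0 = 0.
Proof. by rewrite /qbracket big_ord0. Qed.

Lemma qbracket1 : qbracket q 1 = 1.
Proof. by rewrite qbracketS qbracket0 mulr0 add0r expr0 invr1. Qed.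

(** The value 0 at negative integers agrees with the truncated subtraction in [xi_q]. *)
Definition qbracketz h : k := if h is Posz d then qbracket q d else 0.

Definition height I S (t : nat) : int := #|below I t|%:Z - #|below S t|%:Z.

Lemma height0 I S : height I S 0 = 0.
Proof.
rewrite /height; have E (T : {set 'I_n}) : below T 0 = set0.
  by apply/setP=> x; rewrite !inE ltn0 andbF.
by rewrite !E subrr.
Qed.

Lemma heightS I S t (tn : (t < n)%N) : height I S t.+1 =
  height I S t + (Ordinal tn \in I)%:Z - (Ordinal tn \in S)%:Z.
Proof. by rewrite /height !(card_below_S _ tn) !PoszD; ring. Qed.

Lemma height_full I S : height I S n = #|I|%:Z - #|S|%:Z.
Proof. by rewrite /height !below_full. Qed.

(* [i], [m], [s] tell whether the column belongs to I, M, S; the path goes up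
   by [i] and down by [s]. *)
Definition col_weight (i m s : bool) h : k :=
  match i, m with
  | true, true => if s then q else 0
  | false, false => if s then 0 else 1
  | true, false => (- q) ^ (- h)
  | false, true => if s then qhat q * qbracketz h else (- q) ^ (- h)
  end.

Definition set_weight I M S (x : 'I_n) := col_weight (x \in I) (x \in M) (x \in S) (height I S x).

(** The local hypothesis of [telescope_prod]. Here [a] tells whether the column belongs to
    [natural I M S], and the weight at [h - 1] is that of a path lowered by an element added to S
    further left. *)
Lemma col_weight_step (i m s : bool) h (a := (i && m) || ((i || m) && ~~ s))
    (b := fun h => - (- q) ^ (h - 1) * qbracketz h) :
  0 <= h ->
  col_weight i m s h * b (h + i%:Z - s%:Z)
    + (if s then 0 else if i && ~~ m then (- q) ^ (- h)
       else if m && ~~ i then qhat q * qbracketz h else 0)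
    - b h * (col_weight i m s (h - 1) * ((if a then - q else 1) * (if s then (- q)^-1 else 1))) = 0.
Proof.
case: h => // d _; rewrite /a /b {a b} /qhat.
have P : (- q) ^ (d%:Z - 1) = (- q) ^+ d / - q.
  by rewrite expfzDr // exprN1.
have P' : (- q) ^ (- (d%:Z - 1)) = (- q) ^- d * - q.
  by rewrite opprB addrC expfzDr // exprnN expr1z.
have pd0 : (- q) ^+ d != 0 by rewrite expf_neq0.
have Q : (- q) ^ (d%:Z + 1 - 1) = (- q) ^+ d by rewrite addrK.
have D : d%:Z + 1 - 1 = d%:Z by rewrite addrK.
have Z : qbracketz (d%:Z + 1) = qbracket q d.+1 by rewrite -PoszD addn1.
(* At height 0 the recursion for brackets cannot be used at [h - 1], but there [b h = 0] removes
   that term. *)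
have [->|[c dc]] : d = 0%N \/ exists c, d = c.+1.
  by case: d {P P' pd0 Q Z D} => [|c]; [left|right; exists c].
  case: i m s => [] [] [] //=; rewrite ?qbracket0 ?qbracket1
    ?(mul0r, mulr0, addr0, subr0, oppr0) //=.
  by rewrite addrK !expr0z mulr1 mulrN1 addNr.
have Y : qbracketz (d%:Z - 1) = qbracket q c by rewrite dc -addn1 PoszD addrK.
have Pc : (- q) ^ (d%:Z - 1 - 1) = (- q) ^+ d / - q / - q.
  by rewrite expfzDr // exprN1 P.
case: i m s => [] [] [] /=; rewrite ?addr0 ?subr0 ?Q ?D ?Z ?Y ?Pc ?P ?P' -?exprnN
    ?addn0 ?addn1 ?qbracketS /=;
  move: pd0; move: ((- q) ^+ d) (qbracket q d) (qbracket q c) => x y z x0;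
  rewrite ?mul0r ?mulr0 ?addr0 ?subr0 //;
  rewrite /qhat; try (by field; rewrite ?oppr_eq0 ?q0 ?x0).
Qed.

(** A step down from height 0 has weight 0: it carries either the bracket of 0 or the weight 0 of an
    element outside [I] and [M]. *)
Lemma height_nonneg I M S t : (t <= n)%N ->
  \prod_(x < n | (x < t)%N) set_weight I M S x != 0 -> 0 <= height I S t.
Proof.
elim: t => [|t IH] tn; first by rewrite height0.
rewrite (big_ord_ltS _ tn xpredT) /= (heightS _ _ tn) mulf_eq0 negb_or => /andP[w0].
move/(IH (ltnW tn)) => h0; move: w0; rewrite /set_weight /col_weight /=.
case: (_ \in I); case: (_ \in S) => /=; try by lia.
case: (_ \in M); rewrite ?eqxx //.
have [->|] := eqVneq (height I S t) 0; first by rewrite /= qbracket0 mulr0 eqxx.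
by lia.
Qed.

(* The coefficient of [f_(natural I M S) e_S] in [e_I f_M]. *)
Definition braid_coef I M S : k :=
  if #|S| == #|I| then \prod_x set_weight I M S x else 0.

(** Adding [s] leaves the heights up to [s] unchanged and lowers all later ones by one. *)
Lemma prod_set_weight_add I M S s : s \notin S ->
  \prod_x set_weight I M (s |: S) x =
  (\prod_(x < n | (x < s)%N) set_weight I M S x)
  * col_weight (s \in I) (s \in M) true (height I S s)
  * \prod_(x < n | (s < x)%N) col_weight (x \in I) (x \in M) (x \in S) (height I S x - 1).
Proof.
move=> sS; rewrite (prod_split_at _ s) /set_weight; congr (_ * _ * _).
- apply: eq_bigr => x xs; have xNs : (x == s) = false.
    by apply: contraTF xs => /eqP ->; rewrite ltnn.
  rewrite !inE xNs /height; congr (col_weight _ _ _ (_ - _)); congr (Posz #|pred_of_set _|).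
  apply/setP=> y; rewrite !inE; case: eqP => // ->.
  by rewrite (ltnNge s x) (ltnW xs) (negPf sS).
- rewrite setU11 /height; congr (col_weight _ _ _ (_ - _)); congr (Posz #|pred_of_set _|).
  by rewrite belowU1.
- apply: eq_bigr => x sx; have xNs : (x == s) = false.
    by apply: contraTF sx => /eqP ->; rewrite ltnn.
  rewrite !inE xNs /height; congr col_weight.
  have -> : below (s |: S) x = s |: below S x.
    by apply/setP=> y; rewrite !inE; case: eqP => // ->; rewrite sx.
  by rewrite cardsU1 inE (negPf sS) /= PoszD; ring.
Qed.

(** Abel summation along the path. The summands are the ways to reach [S] by removing one element
    [s], with the powers of -q produced by the reordering; this gives the coefficient when a new
    greatest element joins [M]. *)
Lemma braid_coef_sum I M S : #|S|.+1 = #|I| ->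
  \sum_(s | (s \notin S) && (s \notin natural I M (s |: S)))
     (\prod_x set_weight I M (s |: S) x)
     * ((- q) ^+ #|above (natural I M S) s| * (- q) ^- #|above S s|) =
  \prod_x set_weight I M S x.
Proof.
move=> cardS.
(* In these terms the summand of [s] is the weight before [s], times [v s], times the product of
   [w'] after [s]; [w'] spreads the two powers of -q over the columns above [s]. *)
pose b t : k := - (- q) ^ (height I S t - 1) * qbracketz (height I S t).
pose v s : k := if s \in S then 0
  else if (s \in I) && (s \notin M) then (- q) ^ (- height I S s)
  else if (s \in M) && (s \notin I) then qhat q * qbracketz (height I S s) else 0.
pose w' x : k := col_weight (x \in I) (x \in M) (x \in S) (height I S x - 1) *
  ((if x \in natural I M S then - q else 1) * (if x \in S then (- q)^-1 else 1)).
have := @telescope_prod k n (set_weight I M S) v w' b.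
(* The path starts at height 0, where [b] vanishes, and ends at height 1, where [b] is -1; the
   telescoped value is thus the full product of weights. *)
rewrite /b height0 height_full -cardS -addn1 PoszD [_ + 1]addrC addrK /= qbracket0 qbracket1.
rewrite subrr expr0z mulr0 mul0r mulr1 mulN1r add0r opprK => <-; last first.
  (* The local identity requires a nonnegative height, which holds when the prefix product is
     nonzero; otherwise there is nothing to prove. *)
  move=> s; case: (eqVneq (\prod_(x < n | (x < s)%N) set_weight I M S x) 0) => [->|W0].
    by rewrite mul0r.
  have /= h0 := height_nonneg (ltnW (ltn_ord s)) W0.
  rewrite (heightS _ _ (ltn_ord s)) /v /w' /set_weight.
  have -> : Ordinal (ltn_ord s) = s by apply: val_inj.
  rewrite [in s \in natural I M S]inE inE [in s \in (I :|: M) :\: S]inE inE [~~ _ && _]andbC.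
  by have := col_weight_step (s \in I) (s \in M) (s \in S) h0 => /= ->; rewrite mulr0.
rewrite [RHS](bigID (fun s : 'I_n => (s \notin S) && (s \notin natural I M (s |: S)))) /=.
rewrite [X in _ + X]big1 ?addr0 => [|s]; last first.
  rewrite /v !inE eqxx /= orbF; case: (s \in S) => //=; rewrite ?mulr0 ?mul0r //.
  by rewrite negbK => /andP[-> ->]; rewrite /= mulr0 mul0r.
apply: eq_bigr => s /andP[sS sA]; rewrite prod_set_weight_add //.
rewrite /w' !big_split /= !prod_if_above exprVn -!mulrA; congr (_ * _).
rewrite [X in _ = X]mulrCA [X in X = _]mulrCA; congr (_ * _).
congr (_ * _); move: sA; rewrite /v (negPf sS) !inE eqxx /= orbF /col_weight.
by case: (s \in I); case: (s \in M).
Qed.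

End Weights.

(** * Reindexing sums over finite sets *)

Section SetSums.
Variables (V : zmodType) (T : finType).
Implicit Types (S : {set T}) (m s : T).

Lemma big_set_add1 m (F : {set T} -> V) (P : pred {set T}) :
  \sum_(S : {set T} | P S && (m \in S)) F S =
  \sum_(S : {set T} | P (m |: S) && (m \notin S)) F (m |: S).
Proof.
rewrite (reindex_onto (fun S => m |: S) (fun S => S :\ m)) => [|S /andP[_ mS]] /=; last first.
  by rewrite setD1K.
apply: eq_bigl => S; rewrite setU11 andbT; congr (_ && _).
apply/eqP/idP => [<-|mS]; first by rewrite !inE eqxx.
by rewrite setU1K.
Qed.

Lemma big_set_split m (F : {set T} -> V) :
  \sum_S F S = \sum_(S : {set T} | m \notin S) (F S + F (m |: S)).
Proof.
rewrite (bigID (fun S : {set T} => m \in S)) /= addrC big_split /=; congr (_ + _).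
exact: (big_set_add1 m F xpredT).
Qed.

Lemma big_set_mem (F : {set T} -> T -> V) :
  \sum_(S : {set T}) \sum_(s in S) F S s =
  \sum_(S : {set T}) \sum_(s | s \notin S) F (s |: S) s.
Proof.
rewrite (exchange_big_dep xpredT) //= [RHS](exchange_big_dep xpredT) //=.
by apply: eq_bigr => s _; apply: (big_set_add1 s (F^~ s) xpredT).
Qed.

End SetSums.

(** * Recursion for the coefficients under a new greatest index *)

Section Coefficients.
Variables (k : fieldType) (q : k) (n : nat).
Hypothesis q0 : q != 0.
Implicit Types (I M S : {set 'I_n}) (m : 'I_n).

Lemma set_weight_neq0_sub I M S : \prod_x set_weight q I M S x != 0 ->
  (S \subset I :|: M) && (I :&: M \subset S).
Proof.
move/prodf_neq0 => H; apply/andP; split; apply/subsetP=> x; move: (H x isT);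
  rewrite /set_weight /col_weight !inE;
  by case: (x \in I) (x \in M) (x \in S) => [] [] []; rewrite ?eqxx.
Qed.

Lemma braid_coef_neq0 I M S : braid_coef q I M S != 0 ->
  [/\ #|S| = #|I|, S \subset I :|: M & I :&: M \subset S].
Proof.
rewrite /braid_coef; case: (#|S| =P #|I|) => [cS W0|]; last by rewrite eqxx.
by have /andP[] := set_weight_neq0_sub W0.
Qed.

Section Top.
Variables (I M : {set 'I_n}) (m : 'I_n).
Hypothesis Im : forall i, i \in I -> (i < m)%N.
Hypothesis Mm : forall i, i \in M -> (i < m)%N.

Lemma natural_top S x : S \subset I :|: M -> x \in natural I M S -> (x < m)%N.
Proof.
by move=> SIM; rewrite !inE => /orP[/andP[/Im]//|/andP[_ /orP[/Im|/Mm]]].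
Qed.

Lemma sub_top S x : S \subset I :|: M -> x \in S -> (x < m)%N.
Proof. by move/subsetP=> SIM /SIM; rewrite inE => /orP[/Im|/Mm]. Qed.

(** The Boolean lets a single lemma cover every way in which [m] can belong to the three sets. *)
Definition add_if (b : bool) S := if b then m |: S else S.

Lemma in_add_if b S x : (x \in add_if b S) = (b && (x == m)) || (x \in S).
Proof. by rewrite /add_if; case: b; rewrite ?inE. Qed.

(** Columns below [m] keep their weight, column [m] sees the final height, and columns above [m] lie
    outside [I] and [M] and do not change. *)
Lemma prod_set_weight_top bi bm bs S : m \notin S ->
  \prod_x set_weight q (add_if bi I) (add_if bm M) (add_if bs S) x =
  col_weight q bi bm bs (#|I|%:Z - #|S|%:Z) * \prod_x set_weight q I M S x.
Proof.
move=> mS.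
have mI : m \in I = false by apply/negP => /Im; rewrite ltnn.
have mM : m \in M = false by apply/negP => /Mm; rewrite ltnn.
have bel b X : below (add_if b X) m = below X m.
  by apply/setP=> y; rewrite inE [RHS]inE in_add_if; case: (eqVneq y m) => [->|_];
    rewrite ?ltnn ?andbF // andbF.
rewrite !(bigD1 (P := xpredT) m) //= [set_weight _ _ _ _ m in LHS]/set_weight /height !bel.
rewrite !in_add_if eqxx !andbT mI mM (negPf mS) !orbF.
have E : \prod_(x < n | x != m) set_weight q (add_if bi I) (add_if bm M) (add_if bs S) x =
    \prod_(x < n | x != m) set_weight q I M S x.
  apply: eq_bigr => x xm; rewrite /set_weight !in_add_if (negPf xm) !andbF /=.
  case: (ltngtP x m) => [xm'|mx|/val_inj/eqP]; last by rewrite (negPf xm).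
    rewrite /height; suff bx b X : below (add_if b X) x = below X x by rewrite !bx.
    apply/setP=> y; rewrite inE [RHS]inE in_add_if.
    by case: (eqVneq y m) => [->|_]; rewrite ?andbF //= [(m < x)%N]ltnNge (ltnW xm') !andbF.
  have -> : x \in I = false by apply/negP => /Im; case: ltngtP mx.
  have -> : x \in M = false by apply/negP => /Mm; case: ltngtP mx.
  by [].
rewrite E {E} [set_weight q I M S m]/set_weight mI mM (negPf mS) mul1r.
(* If the remaining product is nonzero, then [S] is contained in the union of [I] and [M], hence
   lies below [m], and the height at [m] is [#|I| - #|S|]. *)
have [->|P0] := eqVneq (\prod_(x < n | x != m) set_weight q I M S x) 0; first by rewrite !mulr0.
have SIM : S \subset I :|: M.
  apply: (proj1 (andP (set_weight_neq0_sub _))); rewrite (bigD1 m) //= mulf_neq0 //.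
  by rewrite /set_weight mI mM (negPf mS) oner_eq0.
have full (X : {set 'I_n}) : (forall i, i \in X -> (i < m)%N) -> below X m = X.
  by move=> Xm; apply/setP=> y; rewrite inE andb_idr //; apply: Xm.
by rewrite !full // => i; apply: sub_top.
Qed.

Lemma card_add_if b S : m \notin S -> #|add_if b S| = (b + #|S|)%N.
Proof. by case: b => //= mS; rewrite cardsU1 mS. Qed.

Let mI : m \notin I. Proof. by apply/negP => /Im; rewrite ltnn. Qed.

Lemma braid_coef_top bi bm bs S : m \notin S ->
  braid_coef q (add_if bi I) (add_if bm M) (add_if bs S) =
  if (bs + #|S| == bi + #|I|)%N then
    col_weight q bi bm bs (#|I|%:Z - #|S|%:Z) * \prod_x set_weight q I M S x else 0.
Proof. by move=> mS; rewrite /braid_coef !card_add_if // prod_set_weight_top. Qed.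

Lemma braid_coef_both0 S : m \notin S -> braid_coef q (m |: I) (m |: M) S = 0.
Proof.
move=> mS; rewrite (braid_coef_top true true false) //= mul0r; by case: ifP.
Qed.

Lemma braid_coef_both1 S : m \notin S ->
  braid_coef q (m |: I) (m |: M) (m |: S) = q * braid_coef q I M S.
Proof.
move=> mS; rewrite (braid_coef_top true true true) //= !add1n eqSS /braid_coef.
by case: ifP; rewrite ?mulr0.
Qed.

(** If the cardinals agree, the path of [I] and [S] would end at height -1, so its weight is 0. *)
Lemma braid_coef_e0 S : m \notin S -> braid_coef q (m |: I) M S = 0.
Proof.
move=> mS; rewrite (braid_coef_top true false false) //= add0n add1n.
case: eqP => // cS; apply/eqP; rewrite mulf_eq0; apply/orP; right.
apply: contraT => W0.
have: 0 <= height I S n.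
  apply: (height_nonneg q0 (M := M)) => //; rewrite (eq_bigl xpredT) // => x.
  by rewrite ltn_ord.
by rewrite height_full cS -addn1 PoszD opprD addrA subrr.
Qed.

Lemma braid_coef_e1 S : m \notin S ->
  braid_coef q (m |: I) M (m |: S) = braid_coef q I M S.
Proof.
move=> mS; rewrite (braid_coef_top true false true) //= !add1n eqSS /braid_coef.
by case: eqP => // ->; rewrite subrr oppr0 expr0z mul1r.
Qed.

Lemma braid_coef_f0 S : m \notin S ->
  braid_coef q I (m |: M) S = braid_coef q I M S.
Proof.
move=> mS; rewrite (braid_coef_top false true false) //= /braid_coef !add0n.
by case: eqP => // ->; rewrite subrr oppr0 expr0z mul1r.
Qed.

(** Column [m] contributes qhat times the bracket of 1, and [braid_coef_sum] unfolds the remaining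
    product into the sum that arises from [oprod_exchange]. *)
Lemma braid_coef_f1 S : m \notin S ->
  braid_coef q I (m |: M) (m |: S) =
  qhat q * \sum_(s | (s \notin S) && (s \notin natural I M (s |: S)))
     braid_coef q I M (s |: S)
     * ((- q) ^+ #|above (natural I M S) s| * (- q) ^- #|above S s|).
Proof.
move=> mS; rewrite (braid_coef_top false true true) //= add0n add1n.
case: eqP => cS; last first.
  rewrite big1 ?mulr0 // => s /andP[sS _].
  by rewrite /braid_coef cardsU1 sS add1n; case: eqP; rewrite ?mul0r.
rewrite -(braid_coef_sum q0 _ cS) -cS -addn1 PoszD [_ + 1]addrC addrK /= qbracket1 // mulr1.
congr (_ * _); apply: eq_bigr => s /andP[sS _]; congr (_ * _).
by rewrite /braid_coef cardsU1 sS add1n cS eqxx.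
Qed.

End Top.
End Coefficients.

(** * The exchange formula for ordered products in a braided algebra *)

Section BraidedExchange.
Variables (k : fieldType) (q : k) (n : nat) (B : algType k) (e f : 'I_n -> B).
Hypothesis q0 : q != 0.
Hypothesis br : braided q val e f.
Implicit Types (I M S : {set 'I_n}) (m : 'I_n).

Definition exchange_rule I M := oprod e I * oprod f M =
  \sum_S braid_coef q I M S *: (oprod f (natural I M S) * oprod e S).

Section Top.
Variables (I M : {set 'I_n}) (m : 'I_n).
Hypothesis Im : forall i, i \in I -> (i < m)%N.
Hypothesis Mm : forall i, i \in M -> (i < m)%N.
Hypothesis IM : exchange_rule I M.

Let mI : m \in I = false. Proof. by apply/negP => /Im; rewrite ltnn. Qed.
Let mM : m \in M = false. Proof. by apply/negP => /Mm; rewrite ltnn. Qed.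

Lemma exchange_rule_top : oprod e I * oprod f M =
  \sum_(S : {set 'I_n} | m \notin S) braid_coef q I M S *: (oprod f (natural I M S) * oprod e S).
Proof.
rewrite IM [RHS]big_mkcond; apply: eq_bigr => S _; case: ifPn => // /negPn mS.
have [->|/braid_coef_neq0[_ SIM _]] := eqVneq (braid_coef q I M S) 0.
  by rewrite scale0r.
by have := sub_top Im Mm SIM mS; rewrite ltnn.
Qed.

Lemma natural_both S : m \notin S ->
  natural (m |: I) (m |: M) (m |: S) = m |: natural I M S.
Proof.
by move=> mS; apply/setP=> x; rewrite !inE; case: eqP => // ->; rewrite orbT.
Qed.

Lemma natural_e S : m \notin S -> natural (m |: I) M (m |: S) = natural I M S.
Proof.
by move=> mS; apply/setP=> x; rewrite !inE; case: eqP => // ->; rewrite mI mM /= andbF.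
Qed.

Lemma natural_f0 S : m \notin S -> natural I (m |: M) S = m |: natural I M S.
Proof.
by move=> mS; apply/setP=> x; rewrite !inE; case: eqP => // ->; rewrite mI mM mS /=.
Qed.

Lemma natural_f1 S : m \notin S -> natural I (m |: M) (m |: S) = natural I M S.
Proof.
by move=> mS; apply/setP=> x; rewrite !inE; case: eqP => // ->; rewrite mI mM /= andbF.
Qed.

Lemma scale_coef S (x y : B) : (S \subset I :|: M -> x = y) ->
  braid_coef q I M S *: x = braid_coef q I M S *: y.
Proof.
have [->|/braid_coef_neq0[_ SIM _]] := eqVneq (braid_coef q I M S) 0.
  by rewrite !scale0r.
by move=> ->.
Qed.

(** Once e_m has passed f_M, the product e_m f_m becomes q f_m e_m. Moving f_m to the left through
    e_S creates correction terms that end in e_m, and the final e_m kills them. *)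
Lemma exchange_rule_both : exchange_rule (m |: I) (m |: M).
Proof.
rewrite /exchange_rule !oprod_max // -mulrA [e m * _]mulrA (oprod_exchange_gt br Mm).
rewrite !mulrA exchange_rule_top -mulrA (br_efii br) -scalerAr mulr_suml scaler_sumr.
rewrite [RHS](big_set_split m); apply: eq_bigr => S mS.
rewrite braid_coef_both0 // scale0r add0r braid_coef_both1 // natural_both //.
rewrite -[RHS]scalerA -scalerAl; congr (_ *: _); apply: scale_coef => SIM.
have Sm x : x \in S -> (x < m)%N by apply: sub_top SIM.
have Am x : x \in natural I M S -> (x < m)%N by apply: natural_top SIM.
rewrite !oprod_max // -!mulrA; congr (_ * _); rewrite !mulrA (oprod_exchange q0 br Sm).
rewrite mulrDl -scalerAl mulr_suml big1 ?scaler0 ?addr0 // => s _.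
by rewrite -scalerAl -!mulrA (br_ee br) !mulr0 scaler0.
Qed.

Lemma exchange_rule_e : exchange_rule (m |: I) M.
Proof.
rewrite /exchange_rule oprod_max // -mulrA (oprod_exchange_gt br Mm) mulrA.
rewrite exchange_rule_top mulr_suml [RHS](big_set_split m); apply: eq_bigr => S mS.
rewrite braid_coef_e0 // scale0r add0r braid_coef_e1 // natural_e // -scalerAl.
apply: scale_coef => SIM; rewrite oprod_max ?mulrA // => x; exact: sub_top SIM.
Qed.

(** Moving f_m through e_S gives a main term, for sets without [m], and corrections that trade some
    [s] in [S] for [m]; the corrections are collected by the set that remains without [s]. *)
Lemma exchange_rule_f : exchange_rule I (m |: M).
Proof.
rewrite /exchange_rule oprod_max // mulrA exchange_rule_top mulr_suml.
rewrite [RHS](big_set_split m) [RHS]big_split /=.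
have E S : m \notin S ->
  braid_coef q I M S *: (oprod f (natural I M S) * oprod e S) * f m =
  braid_coef q I (m |: M) S *: (oprod f (natural I (m |: M) S) * oprod e S) +
  \sum_(s in S) qhat q *: (braid_coef q I M S *: ((- q) ^- #|above S s| *:
     (oprod f (natural I M S) * f s * (oprod e (S :\ s) * e m)))).
  move=> mS; rewrite braid_coef_f0 // natural_f0 //.
  rewrite -!scaler_sumr [qhat q *: _]scalerA [qhat q * _]mulrC -scalerA -scalerDr -scalerAl.
  apply: scale_coef => SIM.
  have Sm x : x \in S -> (x < m)%N by apply: sub_top SIM.
  have Am x : x \in natural I M S -> (x < m)%N by apply: natural_top SIM.
  rewrite oprod_max // -!mulrA (oprod_exchange q0 br Sm) mulrDr; congr (_ + _).
  rewrite -scalerAr mulr_sumr; congr (_ *: _); apply: eq_bigr => s sS.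
  by rewrite -scalerAr !mulrA.
rewrite (eq_bigr _ E) big_split /=; congr (_ + _).
pose t S (s : 'I_n) := qhat q *: (braid_coef q I M S *: ((- q) ^- #|above S s| *:
  (oprod f (natural I M S) * f s * (oprod e (S :\ s) * e m)))).
(* Sets that contain [m] have coefficient 0, so the sum can run over all sets before it is
   reindexed. *)
have t0 S s : m \in S -> t S s = 0.
  move=> mS; rewrite /t (_ : braid_coef q I M S = 0) ?scale0r ?scaler0 //.
  apply: contraTeq mS => /braid_coef_neq0[_ SIM _]; apply/negP => mS.
  by have := sub_top Im Mm SIM mS; rewrite ltnn.
transitivity (\sum_(S : {set 'I_n}) \sum_(s in S) t S s).
  rewrite big_mkcond; apply: eq_bigr => S _; case: ifPn => // /negPn mS.
  by rewrite big1 // => s _; rewrite t0.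
rewrite big_set_mem (bigID (fun S : {set 'I_n} => m \in S)) /= big1 ?add0r => [|S mS].
  apply: eq_bigr => S mS; rewrite braid_coef_f1 // natural_f1 // -scalerA scaler_suml.
  rewrite scaler_sumr [LHS](bigID (fun s => s \notin natural I M (s |: S))) /=.
  (* When [s] already lies in the index set of the f's, inserting [f s] gives 0. *)
  rewrite [X in _ + X]big1 ?addr0 => [|s /andP[_ /negPn sA]].
    apply: eq_bigr => s /andP[sS sA]; rewrite /t -[in RHS]scalerA; congr (_ *: _).
    apply: scale_coef => SIM.
    rewrite (oprod_gen (braided_ext_f br)) (negPf sA) setU1K //.
    have Sm x : x \in S -> (x < m)%N.
      by move=> xS; apply: (sub_top Im Mm SIM); rewrite inE xS orbT.
    rewrite (oprod_max e Sm) -scalerAl scalerA.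
    rewrite aboveU1 mulrC.
    have -> : above (natural I M (s |: S)) s = above (natural I M S) s.
      by apply/setP=> x; rewrite !inE; case: eqP => // ->; rewrite ltnn !andbF.
    have -> // : s |: natural I M (s |: S) = natural I M S.
    have H : s \in I :|: M by move/subsetP: SIM; apply; rewrite setU11.
    apply/setP=> x; move: sA sS H; rewrite !inE eqxx /=; case: (eqVneq x s) => [->|//].
    by case: (s \in I); case: (s \in M); case: (s \in S).
  by rewrite /t (oprod_gen (braided_ext_f br)) sA mul0r !scaler0.
by rewrite big1 // => s _; rewrite t0 // inE mS orbT.
Qed.

End Top.

Lemma exchange_rule0 : exchange_rule set0 set0.
Proof.
rewrite /exchange_rule (bigD1 set0) //= big1 ?addr0 => [|S SN0]; last first.
  rewrite /braid_coef cards0 cards_eq0 (negPf SN0) scale0r //.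
rewrite /braid_coef eqxx big1 => [|x _]; last by rewrite /set_weight !inE.
have -> : natural set0 set0 set0 = set0 :> {set 'I_n} by apply/setP=> x; rewrite !inE.
by rewrite scale1r !oprod0.
Qed.

(** The sets are built up one column at a time; the new column is the greatest so far and joins both
    sets, one of them or neither. *)
Theorem oprod_braid I M : oprod e I * oprod f M =
  \sum_S braid_coef q I M S *: (oprod f (natural I M S) * oprod e S).
Proof.
rewrite -/(exchange_rule I M) -(below_full I) -(below_full M).
suff H t : (t <= n)%N -> exchange_rule (below I t) (below M t) by exact: H.
elim: t => [|t IH] tn.
  have E X : below X 0 = set0 :> {set 'I_n} by apply/setP=> x; rewrite !inE andbF.
  by rewrite !E; apply: exchange_rule0.
pose m := Ordinal tn; have lt X (i : 'I_n) : i \in below X t -> (i < m)%N.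
  by rewrite inE => /andP[].
have belS X : below X t.+1 = if m \in X then m |: below X t else below X t.
  apply/setP=> x; rewrite inE ltnS leq_eqVlt.
  by case: ifP; rewrite !inE -[(x == t :> nat)]/(x == m);
    case: (eqVneq x m) => [->|] //= ->; rewrite ?ltnn ?andbF.
have {}IH := IH (ltnW tn); rewrite !belS; case: ifP; case: ifP => _ _ //.
- by apply: exchange_rule_both IH => i; apply: lt.
- by apply: exchange_rule_e IH => i; apply: lt.
- by apply: exchange_rule_f IH => i; apply: lt.
Qed.

End BraidedExchange.

(** * Words in q-exterior generators and inversions *)

Section Words.
Variables (k : fieldType) (q : k) (n : nat) (B : algType k) (e : 'I_n -> B).
Hypothesis ext_e : q_exterior q e.

Definition inversions t (m : nat) (g : 'I_t -> 'I_m) : nat :=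
  (\sum_(a < t) \sum_(b < t) ((a < b) && (g b < g a)))%N.

Lemma inversionsS t (g : 'I_t.+1 -> 'I_n) : injective g ->
  inversions g = (#|below [set g (lift ord0 b) | b : 'I_t] (g ord0)|
                 + inversions (fun b => g (lift ord0 b)))%N.
Proof.
move=> inj_g; rewrite /inversions big_ord_recl; congr (_ + _)%N; last first.
  by apply: eq_bigr => a _; rewrite big_ord_recl /= add0n.
rewrite big_ord_recl /= add0n.
have -> : below [set g (lift ord0 b) | b : 'I_t] (g ord0) =
    [set g (lift ord0 b) | b in [set b : 'I_t | (g (lift ord0 b) < g ord0)%N]].
  apply/setP=> x; rewrite inE; apply/andP/imsetP => [[/imsetP[b _ ->] bg]|[b]].
    by exists b; rewrite ?inE.
  by rewrite inE => bg ->; rewrite imset_f.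
rewrite card_imset => [|a b /inj_g/lift_inj //].
rewrite -sum1dep_card [RHS]big_mkcond /=; apply: eq_bigr => b _.
by case: (_ < _)%N.
Qed.

(** Induction from the right: inserting the first letter costs -q for each smaller later letter,
    which is its share of the inversions, and a repeated letter gives 0. *)
Lemma prod_word t (g : 'I_t -> 'I_n) : \prod_(l < t) e (g l) =
  if injectiveb g then (- q) ^+ inversions g *: oprod e [set g l | l : 'I_t] else 0.
Proof.
elim: t g => [|t IH] g.
  rewrite big_ord0 /inversions big_ord0 scale1r.
  have -> : [set g l | l : 'I_0] = set0 by apply/setP=> x; rewrite inE; apply/imsetP => -[[]].
  by rewrite oprod0; case: injectiveP => // -[] [].
rewrite big_ord_recl {}IH.
set g' := fun l => g (lift ord0 l).
have im_g : [set g l | l : 'I_t.+1] = g ord0 |: [set g' l | l : 'I_t].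
  apply/setP=> x; rewrite !inE; apply/imsetP/orP => [[l _ ->]|[/eqP->|/imsetP[l _ ->]]].
  - by case: (unliftP ord0 l) => [j|] ->; [right; apply: imset_f | left].
  - by exists ord0.
  - by exists (lift ord0 l).
case: (injectiveP g') => [inj_g'|ninj]; last first.
  rewrite mulr0; case: injectiveP => // inj_g; case: ninj => a b /inj_g.
  exact: lift_inj.
rewrite -scalerAr (gen_oprod ext_e); case: ifPn => [/imsetP[l _ g0]|g0].
  rewrite scaler0; case: injectiveP => // inj_g; have := inj_g _ _ g0.
  by move/eqP; rewrite (negPf (neq_lift ord0 l)).
case: injectiveP => [inj_g|[]]; last first.
  move=> a b; case: (unliftP ord0 a) (unliftP ord0 b) => [i|] -> [j|] -> //.
  - by move/inj_g' ->.
  - by move=> E; case/imsetP: g0; exists i.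
  - by move=> E; case/imsetP: g0; exists j.
by rewrite scalerA -exprD inversionsS // addnC im_g.
Qed.

End Words.

Lemma perm_lengthE t (s : 'S_t) : perm_length s = inversions s.
Proof.
rewrite /perm_length /inversions -sum1dep_card pair_big /= big_mkcond /=.
by apply: eq_bigr => p _; case: ifP.
Qed.

(** * Quantum minors as coefficients of ordered products *)

Section Coaction.
Variables (k : fieldType) (q : k) (n : nat) (B : algType k).
Variable (iota : {lrmorphism Oq n q -> B}) (e : 'I_n -> B).
Hypothesis ext_e : q_exterior q e.
Hypothesis iota_comm : forall a i, GRing.comm (iota a) (e i).

Definition coact (i : 'I_n) : B := \sum_j iota (oq_X q i j) * e j.

Lemma prod_iota_gen t (a : 'I_t -> Oq n q) (g : 'I_t -> 'I_n) :
  \prod_(l < t) (iota (a l) * e (g l)) =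
  iota (\prod_(l < t) a l) * \prod_(l < t) e (g l).
Proof.
elim: t a g => [|t IH] a g; first by rewrite !big_ord0 rmorph1 mulr1.
rewrite !big_ord_recl IH rmorphM !mulrA; congr (_ * _); rewrite -!mulrA; congr (_ * _).
exact/esym/iota_comm.
Qed.

(** The word of column indices in the summand of [s] in [qminor]. For [#|J| = #|I|] these are
    exactly the injective words with image [J], and since [enum J] increases, the word has the
    inversions of [s]. *)
Definition minor_word (I J : {set 'I_n}) (s : 'S_#|I|) : {ffun 'I_#|I| -> 'I_n} :=
  [ffun l => nth (enum_val l) (enum J) (s l)].

Section Word.
Variables I J : {set 'I_n}.
Hypothesis cardJ : #|J| = #|I|.

Lemma minor_word_lt (s : 'S_#|I|) a b :
  (minor_word J s a < minor_word J s b)%N = (s a < s b)%N.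
Proof.
have sz (l : 'I_#|I|) : (l < size (enum J))%N by rewrite -cardE cardJ.
rewrite !ffunE (set_nth_default (enum_val a) (enum_val b)) //.
have lt i j : (i < j)%N -> (j < size (enum J))%N ->
    (nth (enum_val a) (enum J) i < nth (enum_val a) (enum J) j)%N.
  move=> ij sj; apply: (sorted_ltn_nth (@ord_lt_trans n) _ (enum_sorted J)) => //.
  by rewrite inE; apply: ltn_trans sj.
case: (ltngtP (s a) (s b)) => [sab|sba|->]; rewrite ?ltnn //.
  exact: lt _ _ sab (sz _).
by have := lt _ _ sba (sz _); case: ltngtP.
Qed.

Lemma minor_word_inj : injective (@minor_word I J).
Proof.
move=> s1 s2 E; apply/permP=> l; move/ffunP/(_ l)/eqP: E; rewrite !ffunE.
by rewrite nth_uniq ?enum_uniq -?cardE ?cardJ // => /eqP/val_inj.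
Qed.

Lemma minor_word_injective s : injective (@minor_word I J s).
Proof.
move=> a b; rewrite !ffunE (set_nth_default (enum_val a) (enum_val b)) -?cardE ?cardJ //.
by move/eqP; rewrite nth_uniq ?enum_uniq -?cardE ?cardJ // => /eqP/val_inj/perm_inj.
Qed.

Lemma im_minor_word s : [set @minor_word I J s l | l : 'I_#|I|] = J.
Proof.
apply/eqP; rewrite eqEcard card_imset ?card_ord ?cardJ ?leqnn ?andbT; last first.
  exact: minor_word_injective.
apply/subsetP=> x /imsetP[l _ ->]; rewrite ffunE -mem_enum mem_nth //.
by rewrite -cardE cardJ.
Qed.

Lemma minor_word_surj (g : {ffun 'I_#|I| -> 'I_n}) : injective g ->
  [set g l | l : 'I_#|I|] = J -> exists s, g = minor_word J s.
Proof.
move=> inj_g im_g.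
have gJ l : g l \in J by rewrite -im_g imset_f.
have lt l : (index (g l) (enum J) < #|I|)%N.
  by apply: leq_trans (eq_leq cardJ); rewrite (cardE J) index_mem mem_enum.
have inj_idx : injective (fun l => Ordinal (lt l)).
  move=> a b /(congr1 val) /= E; apply: inj_g.
  by rewrite -(nth_index (g a) (s := enum J) (x := g a)) ?mem_enum // E nth_index ?mem_enum.
exists (perm inj_idx); apply/ffunP=> l; rewrite ffunE permE /=.
by rewrite nth_index // mem_enum.
Qed.

Lemma coact_minor : iota (qminor q I J) * oprod e J =
  \sum_(g : {ffun 'I_#|I| -> 'I_n} | injectiveb g && ([set g l | l : 'I_#|I|] == J))
    \prod_(l < #|I|) (iota (oq_X q (enum_val l) (g l)) * e (g l)).
Proof.
rewrite rmorph_sum mulr_suml /=.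
rewrite (eq_bigl (mem [set minor_word J s | s : 'S_#|I|])) => [|g]; last first.
  apply/andP/imsetP => [[/injectiveP inj_g /eqP im_g]|[s _ ->]].
    by have [s ->] := minor_word_surj inj_g im_g; exists s.
  by split; [apply/injectiveP/minor_word_injective | rewrite im_minor_word].
rewrite big_imset /= => [|s1 s2 _ _ /minor_word_inj //]; apply: eq_bigr => s _.
rewrite prod_iota_gen (prod_word ext_e); case: injectiveP => [_|[]]; last first.
  exact: minor_word_injective.
rewrite im_minor_word linearZ /= -scalerAl -scalerAr perm_lengthE.
congr ((- q) ^+ _ *: (iota _ * _)).
  by apply: eq_bigr => a _; apply: eq_bigr => b _; rewrite minor_word_lt.
by apply: eq_bigr => l _; rewrite ffunE.
Qed.

End Word.

(** Expanding the product of sums gives one term for each word of columns; words with a repetition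
    vanish, and the others are grouped by their image. *)
Lemma oprod_coact I : oprod coact I =
  \sum_(J : {set 'I_n} | #|J| == #|I|) iota (qminor q I J) * oprod e J.
Proof.
rewrite {1}/oprod (big_tuple _ _ (enum_tuple I)).
rewrite (eq_bigr (fun l : 'I_#|I| => coact (enum_val l))) => [|l _]; last first.
  by rewrite (tnth_nth (enum_val l)) -enum_val_nth.
rewrite bigA_distr_bigA /=.
rewrite (bigID (fun g : {ffun 'I_#|I| -> 'I_n} => injectiveb g)) /= [X in _ + X]big1 ?addr0.
  rewrite (partition_big (fun g : {ffun 'I_#|I| -> 'I_n} => [set g l | l : 'I_#|I|])
    (fun J => #|J| == #|I|)) /=.
    by apply: eq_bigr => J /eqP cJ; rewrite coact_minor.
  by move=> g /injectiveP inj_g; rewrite card_imset ?card_ord.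
move=> g /negPf ninj; rewrite prod_iota_gen (prod_word ext_e).
by rewrite [injectiveb _]ninj mulr0.
Qed.

End Coaction.

(** Double sums are compared one unordered pair of columns at a time, since the relations of [Oq]
    mix X_ia X_mb with X_ib X_ma. *)
Lemma eq_sum_pairs (V : zmodType) (n : nat) (F G : 'I_n -> 'I_n -> V) :
  (forall a, F a a = G a a) ->
  (forall a b : 'I_n, (a < b)%N -> F a b + F b a = G a b + G b a) ->
  \sum_a \sum_b F a b = \sum_a \sum_b G a b.
Proof.
move=> diag offdiag.
have E (H : 'I_n -> 'I_n -> V) : \sum_a \sum_b H a b =
    \sum_a H a a + \sum_(a < n) \sum_(b < n | (a < b)%N) (H a b + H b a).
  under [X in _ = _ + X]eq_bigr do rewrite big_split.
  rewrite big_split /= [X in _ + (_ + X)](exchange_big_dep xpredT) //= -!big_split /=.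
  apply: eq_bigr => a _; rewrite (bigD1 a) //= (bigID (fun b : 'I_n => (a < b)%N)) /=.
  congr (_ + (_ + _)); apply: eq_bigl => b; rewrite -val_eqE /=; by case: ltngtP.
rewrite !E; congr (_ + _); first exact: eq_bigr.
by apply: eq_bigr => a _; apply: eq_bigr => b; apply: offdiag.
Qed.

(** * The coaction preserves the braided relations *)

Section Comodule.
Variables (k : fieldType) (q : k) (n : nat) (B : algType k).
Variable (iota : {lrmorphism Oq n q -> B}) (e f : 'I_n -> B).
Hypothesis q0 : q != 0.
Hypothesis br : braided q val e f.
Hypothesis e_comm : forall a i, GRing.comm (iota a) (e i).
Hypothesis f_comm : forall a i, GRing.comm (iota a) (f i).

Lemma coact_mul (g h : 'I_n -> B) i m : (forall a i, GRing.comm (iota a) (g i)) ->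
  coact iota g i * coact iota h m =
  \sum_a \sum_b iota (oq_X q i a * oq_X q m b) * (g a * h b).
Proof.
move=> g_comm; rewrite mulr_suml; apply: eq_bigr => a _.
rewrite mulr_sumr; apply: eq_bigr => b _.
by rewrite rmorphM -!mulrA; congr (_ * _); rewrite !mulrA g_comm.
Qed.

Let X := @oq_X k n q.

Lemma iota_scale c u w : iota u * (c *: w) = iota (c *: u) * w.
Proof. by rewrite linearZ -scalerAl -scalerAr. Qed.

Lemma coact_ext (g : 'I_n -> B) : q_exterior q g ->
  (forall a i, GRing.comm (iota a) (g i)) -> q_exterior q (coact iota g).
Proof.
case=> gg hg g_comm; have [Xcol Xrow Xcomm Xcross] := oq_X_relations n q.
split=> [i|i l il]; rewrite !coact_mul //.
  transitivity (\sum_(a < n) \sum_(b < n) (0 : B)).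
    apply: eq_sum_pairs => [a|a b ab]; first by rewrite gg mulr0.
    rewrite (hg a b) // iota_scale -mulrDl -rmorphD (Xrow i a b) // -scalerDl.
    by rewrite subrr scale0r rmorph0 mul0r addr0.
  by rewrite big1 // => a _; rewrite big1.
rewrite scaler_sumr; under [RHS]eq_bigr do rewrite scaler_sumr.
apply: eq_sum_pairs => [a|a b ab]; first by rewrite gg !mulr0 scaler0.
rewrite (hg a b) // !iota_scale !scalerAl -!linearZ /= -!mulrDl -!rmorphD.
congr (iota _ * _); rewrite -/X in Xcol Xrow Xcomm Xcross *.
rewrite -!scalerAl (canRL (subrK _) (Xcross i l a b il ab)) (Xcomm i l b a il ab).
rewrite scalerDr !scalerA [RHS]addrAC -scalerDl; congr (_ + _).
rewrite -[LHS]scale1r; congr (_ *: _); rewrite /qhat.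
by field.
Qed.

Lemma coact_braided : braided q val (coact iota e) (coact iota f).
Proof.
have [ee he] := coact_ext (braided_ext_e br) e_comm.
have [ff hf] := coact_ext (braided_ext_f br) f_comm.
have [Xcol Xrow Xcomm Xcross] := oq_X_relations n q.
rewrite -/X in Xcol Xrow Xcomm Xcross *.
case: br => _ _ _ _ efii ef_gt ef_lt.
(* The two terms of a pair of columns are brought to the order f e by the braiding alone; what
   remains in each case is an identity between coefficients in [Oq]. *)
have words (i m a b : 'I_n) : (a < b)%N ->
  iota (X i a * X m b) * (e a * f b) + iota (X i b * X m a) * (e b * f a) =
  iota (X i a * X m b) * (f b * e a)
  + iota (qhat q *: (X i a * X m b) + X i b * X m a) * (f a * e b).
  move=> ab; rewrite ef_lt // ef_gt // mulrDr iota_scale -addrA -mulrDl -rmorphD //.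
split=> // [i|i m mi|i m im]; rewrite !coact_mul //.
- rewrite scaler_sumr; under [RHS]eq_bigr do rewrite scaler_sumr.
  apply: eq_sum_pairs => [a|a b ab]; first by rewrite efii iota_scale linearZ -scalerAl.
  rewrite words // [RHS]addrC !scalerAl -!linearZ /= -!/X (Xrow i a b ab).
  congr (iota _ * _ + iota _ * _).
  rewrite -scalerAl (Xrow i a b ab) !scalerA -[X in _ + X]scale1r -scalerDl /qhat.
  by congr (_ *: _); field.
- apply: eq_sum_pairs => [a|a b ab].
    by rewrite efii iota_scale -/X (Xcol m i a mi).
  rewrite words // [RHS]addrC -!/X (Xcomm m i b a mi ab).
  congr (_ + iota _ * _).
  by rewrite -(Xcomm m i b a mi ab) -(Xcross m i a b mi ab) subrK.
- rewrite scaler_sumr -big_split /=.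
  under [RHS]eq_bigr do rewrite scaler_sumr -big_split /=.
  apply: eq_sum_pairs => [a|a b ab].
    rewrite efii !iota_scale [X in _ = _ + X]scalerAl -linearZ -mulrDl -rmorphD /=.
    congr (iota _ * _); rewrite -/X (Xcol i m a im) !scalerA.
    by rewrite -[X in _ = X + _]scale1r -scalerDl /qhat; congr (_ *: _); field.
  rewrite words // -!/X !scalerAl -!linearZ /=.
  rewrite [RHS]addrC -!mulrDl -!rmorphD /= -!scalerAl.
  congr (iota _ * _ + iota _ * _).
    by rewrite -(Xcross i m a b im ab) addrC subrK.
  by rewrite addrC (Xcomm i m b a im ab).
Qed.

End Comodule.

(** * Order and cardinality of index sets *)

Section Sets.
Variable n : nat.
Implicit Types (I J M N S T U V : {set 'I_n}).

Lemma card_below_nth S (l : 'I_n) i : (i < #|S|)%N -> nth l (enum S) i = l ->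
  #|below S l| = i.
Proof.
move=> iS nthi; have lS : l \in S by rewrite -nthi -mem_enum mem_nth // -cardE.
have <- : index l (enum S) = i by rewrite -nthi index_uniq ?enum_uniq -?cardE.
rewrite (enum_split S l) lS index_cat mem_enum inE ltnn andbF /= eqxx addn0.
by rewrite -cardE.
Qed.

Lemma ell_sum S T : ell S T = (\sum_(s in S) #|below T s|)%N.
Proof.
rewrite /ell -sum1dep_card (eq_bigr (fun s : 'I_n => \sum_(t in below T s) 1)%N); last first.
  by move=> s _; rewrite sum1_card.
rewrite pair_big_dep /=; apply: eq_bigl => p; by rewrite !inE.
Qed.

Lemma ell_set0 S : ell S set0 = 0%N.
Proof.
rewrite ell_sum big1 // => s _; rewrite (_ : below set0 s = set0) ?cards0 //.
by apply/setP=> x; rewrite !inE.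
Qed.

(** If the i-th element b of [T] were smaller than the i-th element of [S], then [T] would have more
    elements up to b than [S]. *)
Lemma leset_below S T : #|S| = #|T| ->
  (forall t, (t <= n)%N -> (#|below T t| <= #|below S t|)%N) -> leset S T.
Proof.
move=> cST H; rewrite /leset all2E -!cardE cST eqxx /=.
case: (posnP n) => [n0|n_gt0].
  by apply/allP => -[x y]; have := leq_trans (ltn_ord x) (eq_leq n0).
pose x0 := Ordinal n_gt0.
apply/(all_nthP (x0, x0)) => i; rewrite size_zip -!cardE cST minnn => iT.
rewrite nth_zip -?cardE //=; set a := nth _ _ _; set b := nth _ _ _.
rewrite leqNgt; apply/negP => ba.
have ca : #|below S a| = i.
  by apply: card_below_nth; rewrite ?cST //; apply: set_nth_default; rewrite -cardE cST.
have cb : #|below T b| = i.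
  by apply: card_below_nth; rewrite //; apply: set_nth_default; rewrite -cardE.
have bT : b \in T by rewrite -mem_enum mem_nth // -cardE.
have := H b.+1 (ltn_ord b).
rewrite (card_below_S T (ltn_ord b)) (_ : Ordinal _ = b); last exact: val_inj.
rewrite bT cb addn1 leqNgt ltnS -ca => /negP[].
apply: subset_leq_card; apply/subsetP=> x; rewrite !inE => /andP[-> /=] xb.
exact: leq_trans ba.
Qed.

Lemma card_natural I M S : I :&: M \subset S -> S \subset I :|: M -> #|S| = #|I| ->
  #|natural I M S| = #|M|.
Proof.
move=> IMS SIM cS; rewrite /natural cardsU cardsD (setIidPr SIM) cardsU.
have -> : I :&: M :&: ((I :|: M) :\: S) = set0.
  apply/setP=> x; rewrite !inE; apply/negP => /andP[xIM /andP[/negP xS _]].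
  by apply: xS; apply: (subsetP IMS); rewrite inE.
rewrite cards0 subn0 cS.
have := subset_leq_card (subsetIl I M); have := subset_leq_card (subsetIr I M).
lia.
Qed.

End Sets.

(** * Closed form of the coefficients *)

Section Coefs.
Variables (k : fieldType) (q : k) (n : nat).
Hypothesis q0 : q != 0.
Implicit Types (I J M N S T U V : {set 'I_n}).

Lemma qbracketzB (a b : nat) : qbracketz q (a%:Z - b%:Z) = qbracket q (a - b).
Proof.
have [ab|ba] := leqP b a; first by rewrite subzn.
rewrite (eqP (ltnW ba : (a - b == 0)%N)) qbracket0.
have -> : a%:Z - b%:Z = Negz (b - a).-1 by lia.
by [].
Qed.

(** Disjointness turns the count of elements of [V] up to u into a count below u, and the position
    of u in [U] is the number of elements of [U] below it. *)
Lemma xi_qE U V : [disjoint U & V] -> xi_q q U V =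
  \prod_(u in U) qbracketz q (#|below V u|%:Z - #|below U u|%:Z).
Proof.
move=> UV; rewrite big_enum_val /xi_q; apply: eq_bigr => l _.
rewrite qbracketzB; congr (qbracket q (_ - _)).
  congr #|pred_of_set _|; apply/setP=> x; rewrite !inE; case: (boolP (x \in V)) => //= xV.
  rewrite leq_eqVlt val_eqE; case: eqP xV => // -> .
  by rewrite (disjointFr UV) // enum_valP.
apply/esym/card_below_nth; first exact: ltn_ord.
by rewrite -enum_val_nth.
Qed.

Lemma prod_exprz (P : pred 'I_n) (F : 'I_n -> int) :
  \prod_(x | P x) (- q) ^ F x = (- q) ^ (\sum_(x | P x) F x).
Proof.
rewrite (big_morph (fun z => (- q) ^ z) (id1 := 1) (op1 := *%R)) // => a b.
by rewrite expfzDr // oppr_eq0.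
Qed.

Lemma heightD I S x : height I S x = #|below (I :\: S) x|%:Z - #|below (S :\: I) x|%:Z.
Proof.
have E (A C : {set 'I_n}) : #|below A x| = (#|below (A :&: C) x| + #|below (A :\: C) x|)%N.
  rewrite -(cardsID C); congr (_ + _)%N; congr #|pred_of_set _|;
  by apply/setP=> y; rewrite !inE; case: (y \in A); case: (y \in C); case: (_ < _)%N.
by rewrite /height (E I S) (E S I) setIC !PoszD; ring.
Qed.

(** The local weights are sorted by type: q on the common elements, a power of -q on [W], and qhat
    times a bracket on [S :\: I]. The heights add up to [Lexp_nat] and the brackets give [xi_q]. *)
Lemma braid_coef_ge I M S : S \in ge_sets I M ->
  braid_coef q I M S = q ^+ #|I :&: M| * mu q I M S.
Proof.
rewrite inE => /and4P[SIM IMS /eqP cS _]; rewrite /braid_coef cS eqxx.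
pose W := (natural I M S :\: S) :|: (I :\: M).
have E x : set_weight q I M S x = (if x \in I :&: M then q else 1) *
   ((if x \in W then (- q) ^ (- height I S x) else 1) *
    ((if x \in S :\: I then qhat q else 1) *
     (if x \in S :\: I then qbracketz q (height I S x) else 1))).
  have := subsetP SIM x; have := subsetP IMS x; rewrite /set_weight /col_weight !inE.
  case: (x \in I); case: (x \in M); case: (x \in S) => //= H1 H2;
  rewrite ?mulr1 ?mul1r //; solve [by have := H1 isT | by have := H2 isT].
rewrite (eq_bigr _ (fun x _ => E x)) !big_split /= -!big_mkcond /= !prodr_const.
congr (_ * _); rewrite /mu mulrCA mulrA; congr (_ * _ * _).
  rewrite prod_exprz; congr (_ ^ _); rewrite /Lexp_nat -/W !ell_sum.
  rewrite !(big_morph Posz PoszD (erefl 0%:Z)) -sumrB; apply: eq_bigr => x _.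
  by rewrite heightD opprB.
rewrite xi_qE; last first.
  by apply/pred0P=> x /=; rewrite !inE; case: (x \in I); rewrite ?andbF.
apply: eq_bigr => x _; by rewrite heightD.
Qed.

Lemma braid_coef_le I M S : braid_coef q I M S != 0 -> S \in ge_sets I M.
Proof.
move=> c0; have [cS SIM IMS] := braid_coef_neq0 c0.
rewrite inE SIM IMS cS eqxx /=; apply: leset_below => // t tn.
move: c0; rewrite /braid_coef cS eqxx => W0.
have: 0 <= height I S t.
  apply: (height_nonneg q0 (M := M)) => //; apply/prodf_neq0 => x _.
  by move/prodf_neq0: W0; apply.
by rewrite /height subr_ge0 lez_nat.
Qed.

Lemma braid_coefE I M S : braid_coef q I M S =
  if S \in ge_sets I M then q ^+ #|I :&: M| * mu q I M S else 0.
Proof.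
case: ifPn => [/braid_coef_ge //|]; apply: contraNeq; exact: braid_coef_le.
Qed.

Lemma mu_id I M : mu q I M I = 1.
Proof.
rewrite /mu /Lexp_nat setDv !ell_set0 cards0 subrr expr0 expr0z !mul1r.
by rewrite xi_qE ?big_set0 // -setI_eq0 setI0.
Qed.

Lemma lambda_id J N : lambda_tilde q J N J = 1.
Proof.
rewrite /lambda_tilde /Lexp setDv !ell_set0 cards0 subrr expr0 oppr0 expr0z !mul1r.
by rewrite xi_qE ?big_set0 // -setI_eq0 setI0.
Qed.

(** The exponents of the summands are symmetric about 0. *)
Lemma qbracketV d : qbracket q^-1 d = qbracket q d.
Proof.
rewrite /qbracket (reindex_inj rev_ord_inj); apply: eq_bigr => i _ /=.
rewrite -invrN exprz_inv; congr (_ ^ _).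
have := ltn_ord i; lia.
Qed.

End Coefs.

(** * The coefficients at the inverse parameter *)

Section Inverse.
Variables (k : fieldType) (q : k) (n : nat).
Hypothesis q0 : q != 0.
Implicit Types (J N T A : {set 'I_n}).

Lemma natural_swap J N T : J :&: N \subset T -> T \subset J :|: N ->
  natural T (natural J N T) J = N.
Proof.
move=> /subsetP JNT /subsetP TJN; apply/setP=> x; have := JNT x; have := TJN x.
rewrite !inE; case: (x \in J); case: (x \in N); case: (x \in T) => //= H1 H2;
  by [have := H1 isT | have := H2 isT].
Qed.

Lemma natural_setI J N T : J :&: N \subset T -> T \subset J :|: N ->
  T :&: natural J N T = J :&: N.
Proof.
move=> /subsetP JNT /subsetP TJN; apply/setP=> x; have := JNT x; have := TJN x.
rewrite !inE; case: (x \in J); case: (x \in N); case: (x \in T) => //= H1 H2;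
  by [have := H1 isT | have := H2 isT].
Qed.

Lemma natural_setU J N T : J :&: N \subset T -> T \subset J :|: N ->
  T :|: natural J N T = J :|: N.
Proof.
move=> /subsetP JNT /subsetP TJN; apply/setP=> x; have := JNT x; have := TJN x.
rewrite !inE; case: (x \in J); case: (x \in N); case: (x \in T) => //= H1 H2;
  by [have := H1 isT | have := H2 isT].
Qed.

(** With [ge_sets_le] this matches the pairs (T, A) whose product f_A e_T yields e_J f_N with the
    sets [T] of [le_sets J N]: [A] is then determined by [T]. *)
Lemma le_sets_ge J N T : T \in le_sets J N ->
  (J \in ge_sets T (natural J N T)) && (natural T (natural J N T) J == N).
Proof.
rewrite inE => /and4P[TJN JNT /eqP cT leT].
rewrite natural_swap // eqxx andbT inE natural_setI // natural_setU // cT eqxx leT.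
by rewrite subsetUl subsetIl.
Qed.

Lemma ge_sets_le J T A : J \in ge_sets T A ->
  (T \in le_sets J (natural T A J)) && (natural J (natural T A J) T == A).
Proof.
rewrite inE => /and4P[JTA TAJ /eqP cJ leJ].
rewrite natural_swap // eqxx andbT inE natural_setI // natural_setU // cJ eqxx leJ.
by rewrite subsetUl subsetIl.
Qed.

(** Replacing q by its inverse changes the sign of qhat and of the exponent of -q and fixes the
    brackets, which turns [mu] into [lambda_tilde]. *)
Lemma braid_coef_inverse J N T : T \in le_sets J N ->
  braid_coef q^-1 T (natural J N T) J = q ^- #|J :&: N| * lambda_tilde q J N T.
Proof.
move=> TJN; have /andP[ge /eqP nat] := le_sets_ge TJN.
move: TJN; rewrite inE => /and4P[sTJN sJNT _ _].
rewrite braid_coefE ?invr_eq0 // ge natural_setI // exprVn; congr (_ * _).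
rewrite /mu /lambda_tilde qhatV; congr (_ * _ * _).
  rewrite -invrN exprz_inv /Lexp_nat /Lexp nat; congr (_ ^ - (_ - _));
  by rewrite setUC.
by rewrite /xi_q; apply: eq_bigr => l _; rewrite qbracketV.
Qed.

End Inverse.

(** * Reversing products and the inverse exchange formula *)

Section Opposite.
Variables (k : fieldType) (q : k) (n : nat) (B : algType k).
Hypothesis q0 : q != 0.
Implicit Types (e f : 'I_n -> B) (S T A U : {set 'I_n}).

(** Restoring the increasing order takes one factor -q for each pair of elements of [S]. *)
Lemma oprod_opp e S : q_exterior q e ->
  (oprod (e : 'I_n -> opp_alg B) S : B) = (- q) ^+ 'C(#|S|, 2) *: oprod e S.
Proof.
move=> ext_e; elim/set_max_ind: S => [|t S St IH].
  by rewrite !oprod0 cards0 scale1r.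
have tS : t \notin S by apply/negP => /St; rewrite ltnn.
rewrite (oprod_max (e : 'I_n -> opp_alg B) St).
have -> : (oprod (e : 'I_n -> opp_alg B) S * (e t : opp_alg B) : opp_alg B) =
  e t * (oprod (e : 'I_n -> opp_alg B) S : B) :> B by [].
have below_S : below S t = S.
  by apply/setP=> x; rewrite inE andb_idr //; apply: St.
by rewrite IH -scalerAr (gen_oprod ext_e) (negPf tS) scalerA -exprD cardsU1 tS binS bin1 below_S.
Qed.

(** This is [oprod_braid] in the opposite algebra. The reversal factors depend only on cardinals,
    which agree in all terms with a nonzero coefficient, so they cancel. *)
Lemma oprod_braid_inv e f T A : braided q val e f ->
  oprod f A * oprod e T = \sum_U braid_coef q^-1 T A U *: (oprod e U * oprod f (natural T A U)).
Proof.
move=> br.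
have := oprod_braid (invr_neq0 q0) (braided_opp q0 br) T A.
have mulE (x y : opp_alg B) : (x * y : opp_alg B) = (y : B) * (x : B) :> B by [].
move/(congr1 (fun x : opp_alg B => x : B)); rewrite mulE.
rewrite !oprod_opp; try exact: braided_ext_e br; try exact: braided_ext_f br.
set c := (- q) ^+ _; set d := (- q) ^+ _.
have c0 : c != 0 by rewrite expf_neq0 ?oppr_eq0.
have d0 : d != 0 by rewrite expf_neq0 ?oppr_eq0.
rewrite -scalerAl -scalerAr scalerA => E.
apply: (scalerI (mulf_neq0 c0 d0)); rewrite E scaler_sumr; apply: eq_bigr => U _.
have scE (a : k) (x : opp_alg B) : (a *: x : opp_alg B) = a *: (x : B) :> B by [].
have [->|/braid_coef_neq0[cU UTA TAU]] := eqVneq (braid_coef q^-1 T A U) 0.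
  by rewrite !scale0r scaler0.
rewrite scE mulE !oprod_opp; try exact: braided_ext_e br; try exact: braided_ext_f br.
rewrite card_natural // cU -/c -/d -scalerAl -scalerAr !scalerA; congr (_ *: _).
by ring.
Qed.

End Opposite.

(** * From index sets to predicates on [nat] *)

Section Mask.
Variable n : nat.

Definition mask_of (J : {set 'I_n}) (i : nat) : bool := [exists x in J, val x == i].

Lemma mask_ofE (J : {set 'I_n}) (x : 'I_n) : mask_of J x = (x \in J).
Proof.
apply/existsP/idP => [[y /andP[yJ /eqP/val_inj <-]] //|xJ].
by exists x; rewrite xJ eqxx.
Qed.

Lemma oprod_mask (k : fieldType) (B : algType k) (e : nat -> B) J :
  oprod (fun i : 'I_n => e i) J = masked_prod n (mask_of J) e.
Proof.
rewrite /oprod /masked_prod -[RHS]big_filter.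
suff -> : enum J = [seq i : 'I_n <- index_enum _ | mask_of J i] by [].
by rewrite [index_enum _]unlock; apply: eq_filter => x; rewrite mask_ofE.
Qed.

End Mask.

(** * Comparison of coefficients and the exchange of minors *)

Section Main.
Variables (k : fieldType) (q : k) (n : nat).
Hypothesis q0 : q != 0.
Implicit Types (I J M N S T A U : {set 'I_n}).

(** The functionals [phi J N] read off the coefficient in [A] of e_J f_N; they serve as linear
    independence. *)
Lemma braided_dual_basis (A : algType k) : exists (B : algType k)
    (iota : {lrmorphism A -> B}) (e f : 'I_n -> B)
    (phi : {set 'I_n} -> {set 'I_n} -> {additive B -> A}),
  [/\ braided q val e f,
      (forall a i, GRing.comm (iota a) (e i)) /\ (forall a i, GRing.comm (iota a) (f i)),
      forall J N a x, phi J N (iota a * x) = a * phi J N x &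
      forall J N J' N', phi J N (oprod e J' * oprod f N') = ((J == J') && (N == N'))%:R].
Proof.
have [B [iota [e [f [phi [br [ce cf] phiM phi_dual]]]]]] := fock_space q0 A n.
exists B, iota, (fun i : 'I_n => e i), (fun i : 'I_n => f i).
exists (fun J N => phi (mask_of J) (mask_of N)); split=> //.
  by case: br => *; split; auto.
move=> J N J' N'; rewrite !oprod_mask phi_dual; congr (_%:R); congr nat_of_bool.
apply/forallP/andP => [H|[/eqP -> /eqP ->] i]; last by rewrite !eqxx.
by split; apply/eqP/setP=> x; have /andP[/eqP H1 /eqP H2] := H x; rewrite -!mask_ofE.
Qed.

(** The coefficient of e_J f_N in the exchange formula for y_I z_M. In each scalar the first factor
    comes from that formula and the second from reordering f_A e_T. *)
Lemma minor_exchange I J M N : #|I| = #|J| -> #|M| = #|N| ->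
  qminor q I J * qminor q M N =
  \sum_(S in ge_sets I M) \sum_(T in le_sets J N)
    (q ^+ #|I :&: M| * mu q I M S * (q ^- #|J :&: N| * lambda_tilde q J N T)) *:
      (qminor q (natural I M S) (natural J N T) * qminor q S T).
Proof.
move=> cIJ cMN.
have [B [iota [e [f [phi [br [ce cf] phiM phi_dual]]]]]] := braided_dual_basis (Oq n q).
have phiZ c x : phi J N (c *: x) = c *: phi J N x.
  have -> : c *: x = iota (c *: 1) * x by rewrite linearZ rmorph1 -scalerAl mul1r.
  by rewrite phiM -scalerAl mul1r.
have br' := coact_braided q0 br ce cf.
(* Stated for two arbitrary families, since both orders of [e] and [f] occur. *)
have expand g h I1 I2 : q_exterior q g -> q_exterior q h ->
  (forall a i, GRing.comm (iota a) (g i)) -> (forall a i, GRing.comm (iota a) (h i)) ->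
  oprod (coact iota g) I1 * oprod (coact iota h) I2 =
  \sum_(J1 : {set 'I_n} | #|J1| == #|I1|) \sum_(J2 : {set 'I_n} | #|J2| == #|I2|)
    iota (qminor q I1 J1 * qminor q I2 J2) * (oprod g J1 * oprod h J2).
  move=> ext_g ext_h cg ch; rewrite !oprod_coact //.
  rewrite mulr_suml; apply: eq_bigr => J1 _; rewrite mulr_sumr; apply: eq_bigr => J2 _.
  rewrite rmorphM -!mulrA; congr (_ * _); rewrite !mulrA; congr (_ * _).
  by apply/esym/commr_prod => i _; apply: cg.
(* On the left, [phi J N] keeps only the term [I|J][M|N]. *)
have := oprod_braid q0 br' I M; move/(congr1 (phi J N)).
rewrite (expand _ _ _ _ (braided_ext_e br) (braided_ext_f br)) //.
rewrite raddf_sum (bigD1 J) ?cIJ //= raddf_sum (bigD1 N) ?cMN //=.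
rewrite phiM phi_dual !eqxx mulr1.
rewrite [X in _ + X + _]big1 => [|N' /andP[_ /negPf NN']]; last first.
  by rewrite phiM phi_dual [N == _]eq_sym NN' andbF mulr0.
rewrite [X in _ + X]big1 => [|J' /andP[_ /negPf JJ']]; last first.
  rewrite raddf_sum big1 // => N' _.
  by rewrite /= phiM phi_dual [J == _]eq_sym JJ' mulr0.
rewrite !addr0 => ->; rewrite raddf_sum [RHS]big_mkcond; apply: eq_bigr => S _ /=.
rewrite phiZ braid_coefE //; case: ifP => [SIM|_]; last by rewrite scale0r.
under [RHS]eq_bigr do rewrite -scalerA.
rewrite -scaler_sumr; congr (_ *: _).
move: SIM; rewrite inE => /and4P[sSIM sIMS /eqP cS _].
have cSn := card_natural sIMS sSIM cS; move: (natural I M S) cSn => P cP.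
rewrite (expand _ _ _ _ (braided_ext_f br) (braided_ext_e br)) //.
rewrite [X in phi _ _ X]exchange_big /=.
rewrite raddf_sum big_mkcond [RHS]big_mkcond; apply: eq_bigr => T _ /=.
(* In the reordering of f_A e_T only the term with first index set [J] can contribute, and only if
   its second index set is [N]. *)
have term A : phi J N (iota (qminor q P A * qminor q S T) * (oprod f A * oprod e T)) =
    if N == natural T A J then
      braid_coef q^-1 T A J *: (qminor q P A * qminor q S T) else 0.
  rewrite phiM (oprod_braid_inv q0 _ _ br) raddf_sum (bigD1 J) //= big1 ?addr0.
    rewrite phiZ phi_dual eqxx /= -scalerAr.
    by case: eqP => _; rewrite ?mulr1 ?mulr0 ?scaler0.
  by move=> U /negPf UJ; rewrite phiZ phi_dual [J == _]eq_sym UJ scaler0.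
have term0 A : A != natural J N T \/ T \notin le_sets J N ->
    phi J N (iota (qminor q P A * qminor q S T) * (oprod f A * oprod e T)) = 0.
  move=> AT; rewrite term; case: eqP => // NE.
  rewrite braid_coefE ?invr_eq0 //; case: ifP => [/ge_sets_le|]; last by rewrite scale0r.
  by rewrite -NE => /andP[TJN /eqP AE]; case: AT; rewrite ?TJN // AE eqxx.
case: (boolP (T \in le_sets J N)) => [TJN|TJN]; last first.
  case: ifP => // _; rewrite raddf_sum big1 // => A _; apply: term0; by right.
have /andP[ge /eqP nat] := le_sets_ge TJN.
have /and4P[sTJN sJNT /eqP cT _] :
  [&& T \subset J :|: N, J :&: N \subset T, #|T| == #|J| & leset T J].
  by move: TJN; rewrite inE.
rewrite cT cS cIJ eqxx raddf_sum (bigD1 (natural J N T)) /=; last first.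
  by rewrite cP cMN card_natural.
rewrite big1 ?addr0 => [|A /andP[_ AN]]; last by apply: term0; left.
by rewrite term nat eqxx braid_coef_inverse.
Qed.

End Main.

(** Multiplying [minor_exchange] by the power of q on the left cancels the inverse power in its
    scalars. The summand at (I, J) has scalar 1 and equals [M|N][I|J]; it is split off from the
    double sum. *)
Theorem corollary6p4 (k : fieldType) (n : nat) (n_gt0 : (0 < n)%N)
    (q : k) (q_neq0 : q != 0) (I J M N : {set 'I_n})
    (cardIJ : #|I| = #|J|) (cardMN : #|M| = #|N|) :
  q ^+ #|J :&: N| *: (qminor q I J * qminor q M N) =
  q ^+ #|I :&: M| *: (qminor q M N * qminor q I J)
  + q ^+ #|I :&: M| *:
    \sum_(S in ge_sets I M)
      \sum_(T in le_sets J N | (S, T) != (I, J))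
        (mu q I M S * lambda_tilde q J N T) *:
          (qminor q (natural I M S) (natural J N T) * qminor q S T).
Proof.
rewrite (minor_exchange q_neq0 cardIJ cardMN) -scalerDr scaler_sumr.
pose t S T := (mu q I M S * lambda_tilde q J N T) *:
  (qminor q (natural I M S) (natural J N T) * qminor q S T).
transitivity (q ^+ #|I :&: M| *: \sum_(S in ge_sets I M) \sum_(T in le_sets J N) t S T).
  rewrite scaler_sumr; apply: eq_bigr => S _; rewrite !scaler_sumr; apply: eq_bigr => T _.
  rewrite !scalerA; congr (_ *: _); field.
  by rewrite expf_neq0.
congr (_ *: _).
have leset_refl (A : {set 'I_n}) : leset A A.
  by rewrite /leset; elim: (enum A) => //= x s ->; rewrite leqnn.
have IM : I \in ge_sets I M by rewrite inE subsetUl subsetIl eqxx leset_refl.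
have JN : J \in le_sets J N by rewrite inE subsetUl subsetIl eqxx leset_refl.
have natural_id (A C : {set 'I_n}) : natural A C A = C.
  by apply/setP=> x; rewrite !inE; case: (x \in A); case: (x \in C).
have tIJ : t I J = qminor q M N * qminor q I J.
  by rewrite /t mu_id // lambda_id // mulr1 scale1r !natural_id.
rewrite (bigD1 I) //= [in RHS](bigD1 I) //= (bigD1 J) //= tIJ -!addrA.
congr (_ + (_ + _)).
  by apply: eq_bigl => T; rewrite xpair_eqE eqxx.
apply: eq_bigr => S /andP[_ /negPf SI]; apply: eq_bigl => T.
by rewrite xpair_eqE SI andbT.
Qed.
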